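(* Let $0 < \alpha < 1/2$ and $\epsilon > 0$. For all sufficiently large $n$ (depending on $\alpha$ and $\epsilon$), there exists a 2-dimensional simplicial complex $\Delta$ with $n$ vertices, with at least $n^{2+\alpha}$ 2-faces, and with 2-girth at least $n^{2-2\alpha-\epsilon}$.
   Context: The 2-girth of a finite 2-dimensional simplicial complex $X$ is the minimum number of 2-faces in (the support of) a non-zero 2-cycle of $X$ with coefficients in $\mathbb{Z}/2$ (and $\infty$ if there is no non-zero 2-cycle). *)

(* Defs.v *)
From HB Require Import structures.
From mathcomp Require Import all_boot all_order all_algebra.
From mathcomp Require Import all_classical all_reals all_analysis.
Import Order.TTheory GRing.Theory Num.Theory.
Set Implicit Arguments.
Unset Strict Implicit.
Unset Printing Implicit Defensive.
Local Open Scope ring_scope.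

(* Abstract simplicial complexes with vertex set exactly [V]: every singleton
   is a face, and the empty set is not counted as a face. *)
Record simplicial_complex (V : finType) := SimplicialComplex {
  faces :> {set {set V}};
  face_nonempty : forall s, s \in faces -> s != finset.set0;
  face_vertex : forall v, [set v]%SET \in faces;
  face_closed : forall s t, s \in faces -> t != finset.set0 ->
    t \subset s -> t \in faces }.

Section Girth.
Variable V : finType.
Implicit Types (X : simplicial_complex V) (s t : {set V}).

Definition kfaces X (k : nat) : {set {set V}} :=
  [set s in faces X | #|s| == k.+1]%SET.

Definition dimension X : nat := (\max_(s in faces X) #|s|).-1.

(* Z/2-valued functions on all subsets of V; the k-chains of X are those
   supported on [kfaces X k]. *)
Definition chain := {ffun {set V} -> 'F_2}.

Definition support_chain (z : chain) : {set {set V}} :=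
  [set s | z s != 0]%SET.

(* The linear extension of s |-> \sum_(v in s) (s :\ v), written
   coefficientwise; no orientation signs are needed over Z/2. On vertices this
   is the augmented boundary; in positive degree it is the usual one. *)
Definition boundary (z : chain) : chain :=
  [ffun t => \sum_(s : {set V}) z s * \sum_(v in s) (t == s :\ v)%SET%:R].

Definition is_cycle X (k : nat) (z : chain) : Prop :=
  support_chain z \subset kfaces X k /\ boundary z = 0.

(* The infimum of a nonempty set of natural numbers is attained, and
   the infimum of the empty set is [+oo]. *)
Definition two_girth (R : realType) X : \bar R :=
  ereal_inf [set x : \bar R | exists z : chain,
    [/\ is_cycle X 2 z, z != 0 & x = (#|support_chain z|%:R)%:E]].

End Girth.

(* Main.v *)
Require Import Defs.
From HB Require Import structures.
From mathcomp Require Import all_boot all_order all_algebra.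
From mathcomp Require Import ring lra zify.
Import Order.TTheory GRing.Theory Num.Theory.
Set Implicit Arguments.
Unset Strict Implicit.
Unset Printing Implicit Defensive.

(** Keep each of the triangles on [n] vertices with probability about [n^(alpha - 1)]; about
[n^(2 + alpha)] of them survive. Call a minimal nonempty family of triangles that covers every
edge an even number of times a circuit: the support of a nonzero cycle mod 2 contains one. If the
expected number of surviving circuits with fewer than [n^(2 - 2 alpha - eps)] triangles is
[O(n^2)], then deleting one triangle from each of them costs nothing in comparison with
[n^(2 + alpha)], and the remaining triangles, together with all the edges, form the complex
([deletion_method]; the random choice is one colour class of a uniform colouring). So everything
rests on an upper bound for the number of circuits with [f] triangles, namely
[C^f n^(o(f)) M^(f/2 + 2)] with [M = n + 3 f] ([count_circuits]). Multiplied by the probability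
of survival this gives [n^2 (C n^(alpha - 1/2 + o(1)))^f] for [f <= n] and
[f^2 (C f^(1/2) n^(alpha - 1 + o(1)))^f] for larger [f]; both are geometrically small
in the range at hand ([count_term_le]).

Counting. A circuit is reconstructed triangle by triangle; the state is the list of open edges,
those through which the part already built has to be continued. A new triangle is glued along an
open edge [xy]. Either its apex [w] has to be named, and the number of open edges grows by one, or
it is glued along a second open edge [yw] as well, which has to be selected among the open edges
at [y], and the number of open edges drops by one. As the list starts and ends with three edges,
both kinds of steps occur about [f/2] times. Let [h(y)] be about the number of triangles at
[y], so that [h] has sum at most [M]. Naming [w] out of [M] tickets of which [h(w)] belong to [w]
costs a factor [M / h(w)], and selecting an open edge at [y] costs at most [O(h(y))]. Give
an open edge [ab] the weight [(h(a) h(b))^(1/2)]: a step with apex [w] multiplies the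
weight of the state by [h(w)], and a step closing the angle at [y] divides it by [h(y)]. These
factors cancel the costs, and what remains is [M] per step of the first kind
([size_decode_le]). The profile [h] is told in advance; only vertices with at least a large
constant number [T0] of triangles are listed, so the list has length [3 f / T0] and costs
[n^(O(f / T0))].

Ordering the triangles. The balance of the two kinds of steps breaks down if a triangle is added
all of whose edges are open; this may happen only at the very end. Pair off the triangles of
the circuit at each edge. The resulting dual graph is cubic; it is connected, since a component
would be a smaller even family, and it has no bridge, since the boundary of a family of triangles
cannot be a single edge ([bridgeless]). Hence one can add triangles so that the remaining ones
always form a connected graph ([removable]); this is an st-ordering of the dual graph. The order
is conveyed with a bounded number of bits per triangle: at each moment the first open edge of the
list is either used or discarded, and discarded edges are moved to the end and never needed again
as a starting edge, because a triangle blocked at the time becomes reachable through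
a newer open edge when it stops being blocked ([decode_complete]). *)

(** * The decoder and the number of its outputs *)

Section Decoder.
Local Open Scope ring_scope.
Variable V : finType.
Implicit Types (e : {set V}) (O : seq {set V}) (out : seq {set V}).

Definition delete_nth (T : Type) i (s : seq T) := take i s ++ drop i.+1 s.

Definition symdiff (e e' : {set V}) : {set V} := (e :\: e') :|: (e' :\: e).

Definition cone_edges (w : V) e : seq {set V} :=
  [seq w |: (e :\ x) | x <- enum e].

(** All families reachable from the list [O] of open edges with [r] triangles to go and at most
[k] decisions, each decision bearing on the first open edge [e]: discard it, glue the triangle
with a new apex [w], or glue a triangle that also contains another open edge meeting [e] in [y].
The last option is offered only while few open edges contain [y], which is what bounds the
number of its branches. The last triangle is read off from its three edges. *)
Fixpoint decode (h : V -> nat) (T k r : nat) O : seq (seq {set V}) :=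
  (if (r == 1%N) && (size O == 3%N) then [:: [:: \bigcup_(e <- O) e]] else [::])
  ++ match k, O with
     | k'.+1, e :: O' =>
       decode h T k' r (rcons O' e)
       ++ if r is r'.+1 then
         flatten [seq [seq (w |: e) :: out
                      | out <- decode h T k' r' (cone_edges w e ++ O')]
                 | w <- [seq w <- enum V | w \notin e]]
         ++ flatten [seq flatten [seq [seq (e :|: nth finset.set0 O' i) :: out
             | out <- decode h T k' r' (symdiff e (nth finset.set0 O' i) :: delete_nth i O')]
             | i <- [seq i <- iota 0 (size O') | e :&: nth finset.set0 O' i == [set y]]]
           | y <- [seq y <- enum e | (count (fun e' => y \in e') O' <= T * h y)%N]]
         else [::]
     | _, _ => [::]
     end.

Variables (R : realFieldType) (g : V -> R) (s : R).

(** With [g ^+ 2 = h] and [s ^+ 2 = M] this is the potential that makes the count work. Dividing by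
[s] once per open edge, against a factor [s] for every triangle to go, charges [s ^+ 2] to each
step that names an apex and nothing to each step that closes an angle. *)
Definition edge_weight e : R := (\prod_(x in e) g x) / s.
Definition state_weight O : R := \prod_(e <- O) edge_weight e.

Lemma sum_size_flatten (A B : Type) (f : A -> seq B) (l : seq A) :
  (size (flatten [seq f a | a <- l]))%:R = \sum_(a <- l) (size (f a))%:R :> R.
Proof.
by rewrite size_flatten /shape -map_comp sumnE big_map natr_sum.
Qed.

Lemma state_weight_cons e O : state_weight (e :: O) = edge_weight e * state_weight O.
Proof. by rewrite /state_weight big_cons. Qed.

Lemma state_weight_cat O1 O2 :
  state_weight (O1 ++ O2) = state_weight O1 * state_weight O2.
Proof. by rewrite /state_weight big_cat. Qed.

Lemma state_weight_delete i O : (i < size O)%N ->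
  state_weight O = edge_weight (nth finset.set0 O i) * state_weight (delete_nth i O).
Proof.
move=> lt_i; rewrite -{1}(cat_take_drop i O) (drop_nth finset.set0 lt_i).
by rewrite !state_weight_cat state_weight_cons mulrCA.
Qed.

Hypotheses (g_gt0 : forall x, 0 < g x) (s_gt0 : 0 < s).

Lemma edge_weight_gt0 e : 0 < edge_weight e.
Proof. by rewrite divr_gt0 // prodr_gt0. Qed.

Lemma state_weight_gt0 O : 0 < state_weight O.
Proof. by apply: prodr_gt0 => e _; exact: edge_weight_gt0. Qed.

Lemma edge_weight_cone w e : w \notin e -> #|e| = 2%N ->
  state_weight (cone_edges w e) = edge_weight e * (g w ^+ 2 / s).
Proof.
move=> we /eqP/cards2P-[a [b [ab e_ab]]]; subst e; move: we.
rewrite !inE negb_or => /andP[wa wb].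
have en : perm_eq (enum [set a; b]%SET) [:: a; b].
  apply: uniq_perm; rewrite ?enum_uniq //= ?inE ?ab // => x.
  by rewrite mem_enum !inE.
rewrite /state_weight /cone_edges big_map (perm_big _ en) /= !big_cons big_nil mulr1.
have E1 : ([set a; b] :\ a = [set b])%SET.
  by apply/setP => x; rewrite !inE; case: eqVneq => [->|]//=; rewrite (negbTE ab).
have E2 : ([set a; b] :\ b = [set a])%SET.
  apply/setP => x; rewrite !inE; case: (eqVneq x b) => [->|]//=.
    by rewrite eq_sym (negbTE ab).
  by rewrite orbF.
rewrite E1 E2 /edge_weight !big_setU1 ?inE //= !big_set1.
by field; rewrite gt_eqF.
Qed.

Lemma edge_weight_symdiff e e' y : e :&: e' = [set y]%SET ->
  edge_weight e * edge_weight e' = edge_weight (symdiff e e') * (g y ^+ 2 / s).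
Proof.
move=> eI.
have D1 : \prod_(x in e) g x = g y * \prod_(x in e :\: e') g x.
  by rewrite (big_setID e') /= eI big_set1.
have D2 : \prod_(x in e') g x = g y * \prod_(x in e' :\: e) g x.
  by rewrite (big_setID e) /= finset.setIC eI big_set1.
have D3 : \prod_(x in symdiff e e') g x =
    (\prod_(x in e :\: e') g x) * (\prod_(x in e' :\: e) g x).
  rewrite (big_setID e); congr (_ * _); apply: eq_bigl => x; rewrite !inE.
    by case: (x \in e); rewrite ?andbF ?orbF ?andbT.
  by case: (x \in e); rewrite ?andbF ?orbF ?andbT.
by rewrite /edge_weight D1 D2 D3; field; rewrite gt_eqF.
Qed.

Lemma card_symdiff e e' y : #|e| = 2%N -> #|e'| = 2%N -> e :&: e' = [set y]%SET ->
  #|symdiff e e'| = 2%N.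
Proof.
move=> c c' eI.
have : (#|symdiff e e'| = #|e :\: e'| + #|e' :\: e|)%N.
  apply/eqP; rewrite (leq_card_setU (e :\: e') (e' :\: e)).2.
  by rewrite disjoint_subset; apply/fintype.subsetP => x; rewrite !inE => /andP[/negbTE-> ->].
by rewrite !cardsD c c' [e' :&: e]finset.setIC eI cards1.
Qed.

Lemma card_cone_edge w x e : w \notin e -> x \in e -> #|w |: (e :\ x)| = #|e|.
Proof.
move=> we xe; rewrite cardsU1 !inE negb_and we orbT.
by rewrite (cardsD1 x e) xe.
Qed.

Lemma size_stop_le r O : (forall x, 1 <= g x) ->
  (size (if (r == 1%N) && (size O == 3%N)
         then [:: [:: \bigcup_(e <- O) e]] else [::]))%:R
  <= s ^+ (r + 2)%N * state_weight O.
Proof.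
move=> g1; case: ifP => [/andP[/eqP r1 /eqP O3]|_]; last first.
  by rewrite mulr_ge0 ?exprn_ge0 ?(ltW (state_weight_gt0 _)) ?ltW.
have -> : s ^+ (r + 2)%N = s ^+ size O by rewrite r1 O3.
rewrite /state_weight /edge_weight big_split /= big_const_seq count_predT iter_mulr_1.
rewrite exprVn mulrCA divff ?mulr1 ?gt_eqF ?exprn_gt0 //.
have ge1M (x y : R) : 1 <= x -> 1 <= y -> 1 <= x * y.
  by move=> x1 y1; apply: mulr_ege1.
by elim/big_ind: _ => // e _; elim/big_ind: _.
Qed.

(** Induction on the number of decisions. With [X = s ^+ (r + 2) * state_weight O], discarding
preserves [X]; naming [w] multiplies it by [g w ^+ 2 / s ^+ 2], and these factors sum to at most 1;
closing an angle at [y] divides it by [g y ^+ 2 = h y], while at most [T * h y] open edges are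
available there. So the branches add up to at most [1 + 1 + 2 T] times [X], and the possible stop
contributes one more [X]. *)
Lemma size_decode_le (h : V -> nat) (T : nat) :
  (forall x, g x ^+ 2 = (h x)%:R) -> (forall x, 1 <= g x) ->
  \sum_x g x ^+ 2 <= s ^+ 2 ->
  forall k r O, all (fun e => #|e| == 2%N) O ->
  (size (decode h T k r O))%:R <=
    (3 + 2 * T%:R) ^+ k.+1 * (s ^+ (r + 2)%N * state_weight O).
Proof.
move=> gh g1 sumg k; elim: k => [|k IHk] r O cO.
all: set X := s ^+ (r + 2)%N * state_weight O.
all: have X0 : 0 < X by rewrite mulr_gt0 ?exprn_gt0 ?state_weight_gt0.
all: have T0 : 0 <= T%:R :> R by [].
all: have X1 := size_stop_le r O g1; rewrite -/X in X1.
- rewrite /= cats0 (le_trans X1) // ler_peMl ?ltW //; lra.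
have A1 : 1 <= (3 + 2 * T%:R : R) by lra.
set A := 3 + 2 * T%:R in A1 *.
have A0 : 0 <= A by lra.
have Ak1 : 1 <= A ^+ k.+1 by apply: exprn_ege1.
rewrite [decode _ _ _ _ _]/= size_cat natrD.
suff H : (size (match O with [::] => [::] | e :: O' =>
       decode h T k r (rcons O' e)
       ++ if r is r'.+1 then
         flatten [seq [seq (w |: e) :: out
                      | out <- decode h T k r' (cone_edges w e ++ O')]
                 | w <- [seq w <- enum V | w \notin e]]
         ++ flatten [seq flatten [seq [seq (e :|: nth finset.set0 O' i) :: out
             | out <- decode h T k r' (symdiff e (nth finset.set0 O' i) :: delete_nth i O')]
             | i <- [seq i <- iota 0 (size O') | e :&: nth finset.set0 O' i == [set y]]]
           | y <- [seq y <- enum e | (count (fun e' => y \in e') O' <= T * h y)%N]]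
         else [::] end))%:R <= (2 + 2 * T%:R) * (A ^+ k.+1 * X).
  rewrite exprS -mulrA; set Y := _ * X in H *.
  have YX : X <= Y by rewrite ler_peMl // ltW.
  rewrite (le_trans (lerD X1 H)) // /A.
  by rewrite [leRHS](_ : _ = Y + (2 + 2 * T%:R) * Y); [rewrite lerD2r | ring].
set Y := A ^+ k.+1 * X.
have Y0 : 0 <= Y by rewrite mulr_ge0 ?exprn_ge0 // ltW.
case: O cO @X X0 X1 @Y Y0 => [|e O] cO X X0 X1 Y Y0; first by (apply: mulr_ge0 => //; lra).
have {cO} [/eqP ce cO] := andP (cO : (#|e| == 2%N) && all (fun e => #|e| == 2%N) O).
have S1 : (size (decode h T k r (rcons O e)))%:R <= Y.
  apply: (le_trans (IHk _ _ _)); first by rewrite all_rcons ce eqxx.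
  by rewrite -cats1 state_weight_cat mulrC /Y /X !state_weight_cons
    [state_weight [::]]/state_weight big_nil mulr1 [state_weight O * _]mulrC mulrC.
case: r @X X0 X1 @Y Y0 S1 => [|r] X X0 X1 Y Y0 S1.
  rewrite cats0 (le_trans S1) // ler_peMl //; lra.
rewrite !size_cat !natrD !sum_size_flatten.
have sE : s ^+ (r.+1 + 2)%N = s * s ^+ (r + 2)%N by rewrite addSn exprS.
have S2 : \sum_(w <- [seq w <- enum V | w \notin e])
   (size [seq (w |: e) :: out | out <- decode h T k r (cone_edges w e ++ O)])%:R <= Y.
  apply: (@le_trans _ _ (\sum_(w <- [seq w <- enum V | w \notin e]) Y * (g w ^+ 2 / s ^+ 2))).
    rewrite !big_filter; apply: ler_sum => w we; rewrite size_map.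
    apply: (le_trans (IHk _ _ _)).
      rewrite all_cat cO andbT; apply/allP => f /mapP[x].
      by rewrite mem_enum => xe ->; rewrite card_cone_edge // ce.
    rewrite state_weight_cat edge_weight_cone // /Y /X state_weight_cons.
    rewrite le_eqVlt; apply/orP; left; apply/eqP.
    rewrite sE; field; by rewrite gt_eqF.
  rewrite -mulr_sumr ler_piMr // -mulr_suml ler_pdivrMr ?exprn_gt0 // mul1r.
  apply: le_trans sumg; rewrite big_filter big_enum_cond /=.
  rewrite [leRHS](bigID (fun w => w \notin e)) /= lerDl sumr_ge0 // => i _.
  by rewrite exprn_ge0 // ltW.
have S3 : \sum_(y <- [seq y <- enum e | (count (fun e' => y \in e') O <= T * h y)%N])
   (size (flatten [seq [seq (e :|: nth finset.set0 O i) :: out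
             | out <- decode h T k r (symdiff e (nth finset.set0 O i) :: delete_nth i O)]
             | i <- [seq i <- iota 0 (size O) | e :&: nth finset.set0 O i == [set y]%SET]]))%:R
   <= (2 * T%:R) * Y.
  apply: (@le_trans _ _ (\sum_(y <- [seq y <- enum e | (count (fun e' => y \in e') O <= T * h y)%N])
      T%:R * Y)); last first.
    rewrite big_const_seq iter_addr_0 count_predT -[leLHS]mulr_natl -[leRHS]mulrA.
    apply: ler_wpM2r; first by rewrite mulr_ge0.
    by rewrite (ler_nat _ _ 2) size_filter (leq_trans (count_size _ _)) // -cardE ce.
  rewrite [leLHS]big_filter [leRHS]big_filter; apply: ler_sum => y cy.
  rewrite sum_size_flatten.
  have gy : 0 < g y ^+ 2 by rewrite exprn_gt0.
  apply: (@le_trans _ _ (\sum_(i <- [seq i <- iota 0 (size O) | e :&: nth finset.set0 O i == [set y]%SET])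
     Y / g y ^+ 2)).
    rewrite [leLHS]big_seq_cond [leRHS]big_seq_cond; apply: ler_sum => i.
    rewrite andbT mem_filter mem_iota /= add0n => /andP[/eqP eI lti].
    have ci : #|nth finset.set0 O i| = 2%N by apply/eqP; apply: (allP cO); rewrite mem_nth.
    rewrite size_map; apply: (le_trans (IHk _ _ _)).
      rewrite /= (card_symdiff ce ci eI) eqxx /=.
      move: cO; rewrite -{1}(cat_take_drop i O) (drop_nth finset.set0 lti).
      by rewrite !all_cat /= => /andP[-> /andP[_ ->]].
    rewrite state_weight_cons /Y /X state_weight_cons (state_weight_delete lti).
    rewrite mulrA [edge_weight e * _]mulrA (edge_weight_symdiff eI).
    rewrite le_eqVlt; apply/orP; left; apply/eqP.
    rewrite sE; field; by rewrite !gt_eqF.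
  rewrite big_const_seq iter_addr_0 count_predT -[leLHS]mulr_natl [leLHS]mulrA.
  rewrite ler_pdivrMr // [leRHS]mulrAC ler_wpM2r // gh -natrM ler_nat.
  apply: leq_trans cy.
  rewrite size_filter -[X in (_ <= count _ X)%N](mkseq_nth finset.set0) count_map.
  apply: sub_count => i /= /eqP eI.
  have : y \in e :&: nth finset.set0 O i by rewrite eI inE.
  by rewrite inE => /andP[].
rewrite (le_trans (lerD S1 (lerD S2 S3))) //.
by rewrite le_eqVlt; apply/orP; left; apply/eqP; ring.
Qed.

End Decoder.

Section Membership.
Variable V : finType.
Implicit Types (e : {set V}) (O : seq {set V}) (out : seq {set V}).

Lemma mem_decode_stop h T k e1 e2 e3 :
  [:: e1 :|: (e2 :|: e3)] \in decode h T k 1 [:: e1; e2; e3].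
Proof.
by case: k => [|k]; rewrite /= !big_cons big_nil finset.setU0 inE eqxx.
Qed.

Lemma mem_decode_discard h T k r e O out :
  out \in decode h T k r (rcons O e) -> out \in decode h T k.+1 r (e :: O).
Proof. by move=> H; rewrite /= mem_cat; apply/orP; right; rewrite mem_cat H. Qed.

Lemma mem_decode_cone h T k r w e O out : w \notin e ->
  out \in decode h T k r (cone_edges w e ++ O) ->
  (w |: e) :: out \in decode h T k.+1 r.+1 (e :: O).
Proof.
move=> we H; rewrite /= mem_cat; apply/orP; right.
rewrite mem_cat; apply/orP; right; rewrite mem_cat; apply/orP; left.
apply/flatten_mapP; exists w; first by rewrite mem_filter we mem_enum.
by apply: map_f.
Qed.

Lemma mem_decode_close h T k r e O i y out :
  (i < size O)%N -> e :&: nth finset.set0 O i = [set y]%SET ->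
  (count (fun e' => y \in e') O <= T * h y)%N ->
  out \in decode h T k r (symdiff e (nth finset.set0 O i) :: delete_nth i O) ->
  (e :|: nth finset.set0 O i) :: out \in decode h T k.+1 r.+1 (e :: O).
Proof.
move=> lti eI cy H; rewrite /= mem_cat; apply/orP; right.
rewrite mem_cat; apply/orP; right; rewrite mem_cat; apply/orP; right.
apply/flatten_mapP; exists y.
  rewrite mem_filter cy mem_enum.
  by have : y \in e :&: nth finset.set0 O i by [rewrite eI inE]; rewrite inE => /andP[].
apply/flatten_mapP; exists i; first by rewrite mem_filter eI eqxx mem_iota.
exact: map_f.
Qed.

End Membership.


(** * Pairings and even families of triangles *)

Section Involutions.
Variable T : finType.

Lemma pairing_of_even (A : {set T}) : ~~ odd #|A| ->
  exists f : T -> T, forall x, x \in A -> [/\ f x \in A, f x != x & f (f x) = x].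
Proof.
move: {2}#|A| (leqnn #|A|) => n; elim: n A => [|n IHn] A.
  by rewrite leqn0 cards_eq0 => /eqP-> _; exists id => x; rewrite inE.
case: (set_0Vmem A) => [->|[a aA]] leA oA; first by exists id => x; rewrite inE.
case: (set_0Vmem (A :\ a)) => [A0|[b bA]].
  by move: oA; rewrite (cardsD1 a) aA A0 cards0.
have [f fP] : exists f : T -> T, forall x, x \in A :\ a :\ b ->
    [/\ f x \in A :\ a :\ b, f x != x & f (f x) = x].
  by apply: IHn; move: leA oA; rewrite (cardsD1 a) aA (cardsD1 b) bA /= ?negbK // => /ltnW.
move: bA; rewrite !inE => /andP[ba bA].
exists (fun x => if x == a then b else if x == b then a else f x) => x xA.
case: (eqVneq x a) => [->|xa]; first by rewrite (negbTE ba) eqxx.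
case: (eqVneq x b) => [->|xb]; first by rewrite eqxx eq_sym.
have [] := fP x; first by rewrite !inE xa xb.
by rewrite !inE => /and3P[/negbTE-> /negbTE->].
Qed.

Lemma even_of_pairing (A : {set T}) (f : T -> T) :
  (forall x, x \in A -> [/\ f x \in A, f x != x & f (f x) = x]) -> ~~ odd #|A|.
Proof.
move: {2}#|A| (leqnn #|A|) => n; elim: n A => [|n IHn] A.
  by rewrite leqn0 cards_eq0 => /eqP-> _; rewrite cards0.
case: (set_0Vmem A) => [->|[a aA]] leA fP; first by rewrite cards0.
have [fA fa ffa] := fP a aA.
have fA' : f a \in A :\ a by rewrite !inE fa.
rewrite (cardsD1 a) aA (cardsD1 (f a)) fA' /= negbK; apply: IHn.
  by move: leA; rewrite (cardsD1 a) aA (cardsD1 (f a)) fA' => /ltnW.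
move=> x; rewrite !inE => /and3P[xfa xa xA]; have [fxA fxx ffx] := fP x xA.
split=> //; rewrite fxA andbT; apply/andP; split.
  by apply: contraNneq xa => E; rewrite -ffx E ffa.
by apply: contraNneq xfa => E; rewrite -ffx E.
Qed.

End Involutions.

HB.lock Definition edges_of (V : finType) (F : {set V}) : {set {set V}} :=
  [set e : {set V} | (e \subset F) && (#|e| == 2)].

Section Circuits.
Variable V : finType.
Implicit Types (e F : {set V}) (Z A S : {set {set V}}).


Lemma mem_edges_of e F : (e \in edges_of F) = (e \subset F) && (#|e| == 2).
Proof. by rewrite edges_of.unlock inE. Qed.

Definition even_family Z : bool :=
  [forall F in Z, #|F : {set V}| == 3] &&
  [forall e : {set V}, (#|e| == 2) ==> ~~ odd #|[set F in Z | e \subset F]|].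

Definition circuit Z : bool := minset [pred A | even_family A && (A != finset.set0)] Z.

Lemma even_familyP Z : reflect
  ((forall F, F \in Z -> #|F| = 3) /\
   (forall e, #|e| = 2 -> ~~ odd #|[set F in Z | e \subset F]|))
  (even_family Z).
Proof.
apply: (iffP andP) => -[H1 H2]; split.
- by move=> F FZ; apply/eqP; move/forall_inP: H1; apply.
- by move=> e /eqP ce; move/forallP: H2 => /(_ e); rewrite ce.
- by apply/forall_inP => F FZ; rewrite H1.
- by apply/forallP => e; apply/implyP => /eqP; apply: H2.
Qed.

Lemma card_edges_of F : #|F| = 3 -> #|edges_of F| = 3.
Proof.
move=> c; have -> : edges_of F = [set e : {set V} | e \subset F & #|e| == 2].
  by apply/setP => e; rewrite mem_edges_of inE.
by rewrite cards_draws c.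
Qed.

(** Used to rule out that too many distinct neighbours lie across the edges of one triangle: this is
where the dual graph being cubic matters. *)
Lemma no_four_edges F e1 e2 e3 e4 : #|F| = 3 ->
  {subset [:: e1; e2; e3; e4] <= edges_of F} -> ~~ uniq [:: e1; e2; e3; e4].
Proof.
move=> c sub; apply/negP => un.
have : {subset [:: e1; e2; e3; e4] <= enum (edges_of F)}.
  by move=> x /sub; rewrite mem_enum.
by move/(uniq_leq_size un); rewrite -cardE card_edges_of.
Qed.

Lemma two_edges F e e' : #|F| = 3 -> e \in edges_of F -> e' \in edges_of F -> e != e' ->
  exists x y w, [/\ uniq [:: x; y; w], e = [set x; y], e' = [set x; w] &
    F = w |: [set x; y]].
Proof.
move=> cF; rewrite !mem_edges_of => /andP[eF /eqP ce] /andP[eF' /eqP ce'] ne.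
have cI : #|e :&: e'| = 1.
  have lt2 : #|e :&: e'| < 2.
    rewrite ltn_neqAle -{2}ce subset_leq_card ?subsetIl // andbT.
    apply: contraNneq ne => c2.
    have /eqP E1 : e :&: e' == e by rewrite eqEcard subsetIl c2 ce.
    have /eqP E2 : e :&: e' == e' by rewrite eqEcard subsetIr c2 ce'.
    by rewrite -{1}E1 E2.
  have : #|e :|: e'| <= 3 by rewrite -cF subset_leq_card // subUset eF.
  by rewrite cardsU ce ce'; lia.
have /cards1P[x xE] : #|e :&: e'| == 1 by rewrite cI.
have : x \in e :&: e' by rewrite xE inE.
rewrite inE => /andP[xe xe'].
have /cards1P[y yE] : #|e :\ x| == 1 by move: ce; rewrite (cardsD1 x) xe add1n => -[->].
have /cards1P[w wE] : #|e' :\ x| == 1 by move: ce'; rewrite (cardsD1 x) xe' add1n => -[->].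
have ee : e = [set x; y] by rewrite -(setD1K xe) yE.
have ee' : e' = [set x; w] by rewrite -(setD1K xe') wE.
have yx : y != x by have : y \in e :\ x by [rewrite yE inE]; rewrite !inE => /andP[].
have wx : w != x by have : w \in e' :\ x by [rewrite wE inE]; rewrite !inE => /andP[].
have yw : y != w.
  apply: contraNneq yx => yw; rewrite -in_set1 -xE ee ee' yw !inE eqxx orbT //.
exists x, y, w; split=> //; first by rewrite /= !inE negb_or ![x == _]eq_sym yx wx yw.
apply/eqP; rewrite eq_sym eqEcard cF subUset -ee eF sub1set andbT.
rewrite (fintype.subsetP eF') ?ee' ?inE ?eqxx ?orbT //=.
by rewrite cardsU1 ee cards2 !inE negb_or wx eq_sym yw eq_sym yx.
Qed.

Lemma edges_of_triple F x y w : uniq [:: x; y; w] -> F = w |: [set x; y] ->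
  edges_of F = [set [set x; y]; [set x; w]; [set y; w]].
Proof.
rewrite /= !inE negb_or => /and3P[/andP[xy xw] yw _] FE.
have c3 : #|F| = 3 by rewrite FE cardsU1 !inE cards2 xy negb_or ![w == _]eq_sym xw yw.
apply/eqP; rewrite eq_sym eqEcard card_edges_of //; apply/andP; split.
  apply/fintype.subsetP => e; rewrite mem_edges_of !inE FE.
  by case/orP => [/orP[]|] /eqP->; rewrite cards2 ?xy ?xw ?yw /= andbT;
    apply/fintype.subsetP => z; rewrite !inE => /orP[] ->; rewrite ?orbT.
have n1 : [set x; y] != [set x; w].
  by apply/eqP => /setP/(_ y); rewrite !inE eqxx (negbTE yw) orbT eq_sym (negbTE xy).
have n2 : [set x; y] != [set y; w].
  by apply/eqP => /setP/(_ x); rewrite !inE eqxx (negbTE xy) (negbTE xw).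
have n3 : [set x; w] != [set y; w].
  by apply/eqP => /setP/(_ x); rewrite !inE eqxx (negbTE xy) (negbTE xw).
by rewrite finset.setUC cardsU1 !inE negb_or ![[set y; w] == _]eq_sym n2 n3 cards2 n1.
Qed.

End Circuits.

(** * The dual graph of a circuit *)

Section Pairing.
Variable V : finType.
Implicit Types (e F : {set V}) (Z A S : {set {set V}}).

(** An edge may lie in four or more triangles of [Z]. Pairing these off turns [Z] into the faces of a
closed surface with three neighbours per face: [P e F] is the neighbour of [F] across [e]. *)
Definition pairing Z (P : {set V} -> {set V} -> {set V}) : Prop :=
  forall e F, F \in Z -> e \in edges_of F ->
    [/\ P e F \in Z, e \in edges_of (P e F), P e F != F & P e (P e F) = F].

Lemma pairing_exists Z : even_family Z -> exists P, pairing Z P.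
Proof.
move=> /even_familyP[_ evZ].
have H e : exists f : {set V} -> {set V}, #|e| = 2 -> forall F, F \in Z -> e \subset F ->
    [/\ f F \in Z, e \subset f F, f F != F & f (f F) = F].
  case: (eqVneq #|e| 2) => [/evZ/pairing_of_even[f fP]|ne]; last first.
    by exists id => /eqP; rewrite (negbTE ne).
  exists f => _ F FZ eF; have [] := fP F; first by rewrite inE FZ.
  by rewrite inE => /andP[].
have [P HP] := fin_all_exists H.
exists P => e F FZ; rewrite !mem_edges_of => /andP[eF /eqP ce].
by rewrite ce eqxx andbT; apply: HP.
Qed.

Variables (Z : {set {set V}}) (P : {set V} -> {set V} -> {set V}).
Hypotheses (pairP : pairing Z P) (Z3 : forall F, F \in Z -> #|F| = 3).

Definition closed_in S A : bool :=
  [forall F in A, forall e in edges_of F, (P e F \in S) ==> (P e F \in A)].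

Definition dual_connected S : bool :=
  [forall A : {set {set V}}, [&& A \subset S, A != finset.set0 & closed_in S A] ==> (A == S)].

Lemma closed_inP S A : reflect
  (forall F e, F \in A -> e \in edges_of F -> P e F \in S -> P e F \in A) (closed_in S A).
Proof.
apply: (iffP forall_inP) => [H F e FA eF PS|H F FA].
  by move/forall_inP: (H F FA) => /(_ e eF)/implyP; apply.
by apply/forall_inP => e eF; apply/implyP; apply: H.
Qed.

Lemma dual_connectedP S : reflect
  (forall A, A \subset S -> A != finset.set0 -> closed_in S A -> A = S) (dual_connected S).
Proof.
apply: (iffP forallP) => [H A AS A0 cA|H A].
  by apply/eqP; move: (H A); rewrite AS A0 cA.
by apply/implyP => /and3P[AS A0 cA]; rewrite (H A).
Qed.

Lemma not_closed_in S A : ~~ closed_in S A ->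
  exists F e, [/\ F \in A, e \in edges_of F, P e F \in S & P e F \notin A].
Proof.
rewrite negb_forall_in => /exists_inP[F FA].
rewrite negb_forall_in => /exists_inP[e eF].
by rewrite negb_imply => /andP[PS PA]; exists F, e.
Qed.

Lemma not_dual_connected S : ~~ dual_connected S ->
  exists A, [/\ A \subset S, A != finset.set0, closed_in S A & A != S].
Proof.
rewrite negb_forall => /existsP[A]; rewrite negb_imply => /andP[/and3P[? ? ?] ?].
by exists A.
Qed.

Lemma closed_in_compl S A : S \subset Z -> closed_in S A -> closed_in S (S :\: A).
Proof.
move=> SZ /closed_inP cA; apply/closed_inP => F e; rewrite !inE => /andP[FA FS] eF PS.
rewrite PS andbT; apply/negP => PA.
have [_ ePF _ PPF] := pairP (fintype.subsetP SZ F FS) eF.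
by have := cA (P e F) e PA ePF; rewrite PPF FS (negbTE FA) => /(_ isT).
Qed.

Lemma odd_sum_pred (I : finType) (Q : pred I) (f : I -> nat) :
  odd (\sum_(i | Q i) f i) = \big[addb/false]_(i | Q i) odd (f i).
Proof. by elim/big_rec2: _ => // i b n _ <-; rewrite oddD. Qed.

(** If only one dual edge, through [e0], left [A], then [A] would contain an odd number of triangles
at [e0] and an even number at every other edge. Summed over the edges at an endpoint [x] of [e0],
this is odd; but each triangle of [A] at [x] has exactly two edges there. *)
Lemma bridgeless A F0 e0 : A \subset Z -> F0 \in A -> e0 \in edges_of F0 ->
  P e0 F0 \notin A ->
  exists F e, [/\ F \in A, e \in edges_of F, P e F \notin A & (F, e) != (F0, e0)].
Proof.
move=> AZ F0A eF0 PF0.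
case: (pickP (fun d : {set V} * {set V} => [&& d.1 \in A, d.2 \in edges_of d.1,
  P d.2 d.1 \notin A & d != (F0, e0)])) => [[F e] /and4P[? ? ? ?]|H]; first by exists F, e.
have inA F e : F \in A -> e \in edges_of F -> (F, e) != (F0, e0) -> P e F \in A.
  by move=> FA eF ne; apply: contraFT (H (F, e)) => PA /=; rewrite FA eF PA.
(* Away from [e0] the pairing restricts to [A]; at [e0] it does so once [F0] is removed. *)
have even_deg e : #|e| = 2 -> e != e0 -> ~~ odd #|[set F in A | e \subset F]|.
  move=> ce ne; apply: (@even_of_pairing _ _ (P e)) => F; rewrite !inE => /andP[FA eF].
  have eE : e \in edges_of F by rewrite mem_edges_of eF ce eqxx.
  have [_ ePF nP PP] := pairP (fintype.subsetP AZ F FA) eE.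
  rewrite inA // ?xpair_eqE ?(negbTE ne) ?andbF //.
  by move: ePF; rewrite mem_edges_of => /andP[->].
have ce0 : #|e0| = 2 by move: eF0; rewrite mem_edges_of => /andP[_ /eqP].
have odd_deg : odd #|[set F in A | e0 \subset F]|.
  have F0e : F0 \in [set F in A | e0 \subset F].
    by move: eF0; rewrite inE mem_edges_of F0A => /andP[].
  rewrite (cardsD1 F0) F0e /=.
  apply: (@even_of_pairing _ _ (P e0)) => F; rewrite !inE => /and3P[nF FA eF].
  have eE : e0 \in edges_of F by rewrite mem_edges_of eF ce0 eqxx.
  have [_ ePF nP PP] := pairP (fintype.subsetP AZ F FA) eE.
  rewrite inA // ?xpair_eqE ?(negbTE nF) //.
  split=> //; move: ePF; rewrite mem_edges_of => /andP[-> _]; rewrite !andbT.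
  apply: contraNneq PF0 => <-; rewrite PP //.
have [x xe0] : exists x, x \in e0 by apply/set0Pn; rewrite -card_gt0 ce0.
have E : \sum_(e : {set V} | (#|e| == 2) && (x \in e)) #|[set F in A | e \subset F]| =
         \sum_(F in A | x \in F) 2.
  rewrite (eq_bigr (fun e => \sum_(F in A | e \subset F) 1)); last first.
    by move=> e _; rewrite -sum1_card; apply: eq_bigl => F; rewrite inE.
  rewrite (exchange_big_dep (fun F => (F \in A) && (x \in F))) /=; last first.
    by move=> e F /andP[_ xe] /andP[-> /fintype.subsetP]; apply.
  apply: eq_bigr => F /andP[FA xF].
  have c3 := Z3 (fintype.subsetP AZ F FA).
  have c2 : #|F :\ x| = 2 by move: c3; rewrite (cardsD1 x) xF add1n => -[].
  rewrite -[RHS]c2 -[RHS](@card_in_imset _ _ (fun y => [set x; y]%SET)); last first.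
    move=> y z; rewrite !inE => /andP[yx _] /andP[zx _] /setP/(_ y).
    by rewrite !inE eqxx orbT (negbTE yx) /= => /esym/eqP.
  rewrite -sum1_card; apply: eq_bigl => e; apply/idP/imsetP.
    case/andP=> /andP[/eqP ce xe] /andP[_ eF].
    have /cards1P[y yE] : #|e :\ x| == 1 by move: ce; rewrite (cardsD1 x) xe add1n => -[->].
    have ye : y \in e :\ x by rewrite yE inE.
    exists y; last by rewrite -(setD1K xe) yE.
    by move: ye; rewrite !inE => /andP[-> /(fintype.subsetP eF)].
  case=> y; rewrite !inE => /andP[yx yF] ->.
  rewrite cards2 [x == y]eq_sym yx !inE eqxx FA /=; apply/fintype.subsetP => z.
  by rewrite !inE => /orP[] /eqP->.
have := congr1 odd E; rewrite sum_nat_const muln2 odd_double odd_sum_pred.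
rewrite (bigD1 e0) /= ?ce0 ?xe0 // odd_deg big1 // => e /andP[/andP[/eqP ce _] ne].
by apply/negbTE; apply: even_deg.
Qed.

Lemma sub_minimal_eq A S : minset [pred A | even_family A && (A != finset.set0)] S ->
  A \subset S -> even_family A -> A != finset.set0 -> A = S.
Proof. by move=> /minsetP[_ H] AS eA A0; apply: H => //=; rewrite eA. Qed.

(** A union of components of the dual graph is again an even family. *)
Lemma circuit_connected : circuit Z -> dual_connected Z.
Proof.
move=> cZ; apply/dual_connectedP => A AZ A0 /closed_inP cA.
apply: (sub_minimal_eq cZ) => //; apply/even_familyP; split=> [F FA|e ce].
  by apply: Z3; apply: (fintype.subsetP AZ).
apply: (@even_of_pairing _ _ (P e)) => F; rewrite !inE => /andP[FA eF].
have eE : e \in edges_of F by rewrite mem_edges_of eF ce eqxx.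
have [PZ ePF nP PP] := pairP (fintype.subsetP AZ F FA) eE.
rewrite cA //; split=> //.
by move: ePF; rewrite mem_edges_of => /andP[->].
Qed.

(** A union of components of [Z :\ F] is attached to the rest through [F] alone; a single dual edge
would be a bridge. *)
Lemma two_edges_into F A : dual_connected Z -> F \in Z -> A \subset Z :\ F ->
  A != finset.set0 -> closed_in (Z :\ F) A ->
  exists e e', [/\ e \in edges_of F, e' \in edges_of F, P e F \in A, P e' F \in A & e != e'].
Proof.
move=> /dual_connectedP cZ FZ AS A0 /closed_inP cA.
have FA : F \notin A by apply/negP => /(fintype.subsetP AS); rewrite !inE eqxx.
have AZ : A \subset Z := subset_trans AS (subD1set _ _).
have : ~~ closed_in Z A by apply: contra FA => /(cZ _ AZ A0) ->.
have toF G e : G \in A -> e \in edges_of G -> P e G \notin A -> P e G = F.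
  move=> GA eG PA; have [PZ _ _ _] := pairP (fintype.subsetP AZ G GA) eG.
  by apply: contraNeq PA => nF; apply: cA => //; rewrite !inE nF.
case/not_closed_in => G [e [GA eG _ PA]].
have [G' [e' [GA' eG' PA' ne]]] := bridgeless AZ GA eG PA.
have PF := toF _ _ GA eG PA; have PF' := toF _ _ GA' eG' PA'.
have [_ eF _ PP] := pairP (fintype.subsetP AZ G GA) eG.
have [_ eF' _ PP'] := pairP (fintype.subsetP AZ G' GA') eG'.
rewrite PF in eF PP; rewrite PF' in eF' PP'.
exists e, e'; rewrite PP PP'; split=> //.
by apply: contraNneq ne => E; rewrite -PP -PP' E.
Qed.

(** Two components would need two edges of [F] each. *)
Lemma connected_delete F : dual_connected Z -> F \in Z -> dual_connected (Z :\ F).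
Proof.
move=> cZ FZ; apply/dual_connectedP => A AS A0 cA; apply/eqP; apply: contraT => AnS.
have SZ : Z :\ F \subset Z := subD1set _ _.
have [e1 [e2 [E1 E2 P1 P2 n12]]] := two_edges_into cZ FZ AS A0 cA.
have B0 : (Z :\ F) :\: A != finset.set0.
  by rewrite setD_eq0; apply: contra AnS => H; rewrite eqEsubset AS.
have [e3 [e4 [E3 E4 P3 P4 n34]]] := two_edges_into cZ FZ (subsetDl _ _) B0 (closed_in_compl SZ cA).
have /negP[] : ~~ uniq [:: e1; e2; e3; e4].
  by apply: (no_four_edges (Z3 FZ)) => x; rewrite !inE => /or4P[] /eqP->.
have ne e e' : P e F \in A -> P e' F \in (Z :\ F) :\: A -> e != e'.
  by move=> H; rewrite inE => /andP[H' _]; apply: contraNneq H' => <-.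
by rewrite /= !inE !negb_or n12 n34 !ne.
Qed.

(** Suppose that [F] is adjacent to the triangles outside [S] and separates [S], with [A] on one
side. One edge of [F] leads out of [S] and at least one to the other side, so just one leads
to [A]. It is no bridge, hence some [G] in [A] is adjacent to the outside as well. If [G] is again
separating, one of its sides avoids [F] and lies strictly inside [A]; induction on [#|A|]. *)
Lemma removable_aux S : S \subset Z -> S != Z -> dual_connected Z -> dual_connected S -> 
  forall n F A e, #|A| <= n -> F \in S -> e \in edges_of F -> P e F \notin S ->
  A \subset S :\ F -> A != finset.set0 -> A != S :\ F -> closed_in (S :\ F) A ->
  exists F' e', [/\ F' \in S, e' \in edges_of F', P e' F' \notin S & dual_connected (S :\ F')].
Proof.
move=> SZ SnZ cZ /dual_connectedP cS; elim=> [|n IHn] F A e1.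
  by rewrite leqn0 cards_eq0 => /eqP-> _ _ _ _; rewrite eqxx.
move=> leA FS E1 P1 AS A0 AnS cA.
have SFZ : S :\ F \subset Z := subset_trans (subD1set _ _) SZ.
have toF (B : {set {set V}}) : B \subset S :\ F -> B != finset.set0 -> closed_in (S :\ F) B ->
    exists e, e \in edges_of F /\ P e F \in B.
  move=> BS B0 /closed_inP cB.
  have FB : F \notin B by apply/negP => /(fintype.subsetP BS); rewrite !inE eqxx.
  have : ~~ closed_in S B.
    by apply: contra FB => /(cS _ (subset_trans BS (subD1set _ _)) B0) ->.
  case/not_closed_in => G [e [GB eG PS PB]].
  have [PZ eP _ PP] := pairP (fintype.subsetP SFZ G (fintype.subsetP BS G GB)) eG.
  have EF : P e G = F.
    by apply: contraNeq PB => nF; apply: cB => //; rewrite !inE nF.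
  by exists e; rewrite -EF PP.
have B0 : (S :\ F) :\: A != finset.set0.
  by rewrite setD_eq0; apply: contra AnS => H; rewrite eqEsubset AS.
have cB := closed_in_compl SFZ cA.
have [e2 [E2 P2]] := toF _ (subsetDl _ _) B0 cB.
have [e3 [E3 P3]] := toF _ AS A0 cA.
have AZ : A \subset Z := subset_trans AS SFZ.
have FA : F \notin A by apply/negP => /(fintype.subsetP AS); rewrite !inE eqxx.
have [_ E3' _ PP3] := pairP (fintype.subsetP SZ F FS) E3.
have PA3 : P e3 (P e3 F) \notin A by rewrite PP3.
have [G [e4 [GA E4 P4 ne]]] := bridgeless AZ P3 E3' PA3.
have GSF := fintype.subsetP AS G GA.
have GS : G \in S by move: GSF; rewrite !inE => /andP[].
have PGS : P e4 G \notin S.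
  apply/negP => PS.
  have EF : P e4 G = F.
    by apply: contraNeq P4 => nF; move/closed_inP: cA; apply=> //; rewrite !inE nF.
  have [_ E4F _ PP4] := pairP (fintype.subsetP SZ G GS) E4.
  rewrite EF in E4F PP4.
  have n34 : e3 != e4 by apply: contraNneq ne => E; rewrite E PP4.
  have /negP[] : ~~ uniq [:: e1; e2; e3; e4].
    apply: (no_four_edges (Z3 (fintype.subsetP SZ F FS))) => x.
    by rewrite !inE => /or4P[] /eqP->.
  have neS e : P e F \in S -> e1 != e by move=> H; apply: contraNneq P1 => ->.
  have neA e : P e F \in A -> e2 != e.
    by move=> H; move: P2; rewrite inE => /andP[H' _]; apply: contraNneq H' => ->.
  have P3S : P e3 F \in S by move: (fintype.subsetP AS _ P3); rewrite !inE => /andP[].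
  have P2S : P e2 F \in S by move: P2; rewrite !inE => /and3P[].
  by rewrite /= !inE !negb_or !neS ?neA ?n34 ?PP4.
have [cG|ncG] := boolP (dual_connected (S :\ G)); first by exists G, e4.
(* The part of S :\ G on the other side of G from F lies strictly inside A. *)
have sub (C : {set {set V}}) : C \subset S :\ G -> C != finset.set0 -> C != S :\ G ->
    closed_in (S :\ G) C -> F \notin C ->
    exists F' e', [/\ F' \in S, e' \in edges_of F', P e' F' \notin S & dual_connected (S :\ F')].
  move=> CS C0 CnS cC FC.
  suff CA : C \subset A :\ G.
    apply: (IHn G C e4) => //; rewrite -ltnS; apply: leq_ltn_trans (subset_leq_card CA) _.
    by move: leA; rewrite (cardsD1 G) GA add1n.
  apply/fintype.subsetP => H HC.
  have := fintype.subsetP CS H HC; rewrite !inE => /andP[-> HS] /=.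
  apply: contraT => HA.
  have X0 : C :&: ((S :\ F) :\: A) != finset.set0.
    apply/set0Pn; exists H; rewrite !inE HC HA HS andbT /=.
    by apply: contraNneq FC => <-.
  have XS : C :&: ((S :\ F) :\: A) \subset S.
    by apply: subset_trans (subsetIl _ _) (subset_trans CS (subD1set _ _)).
  have : F \in C :&: ((S :\ F) :\: A).
    rewrite (cS _ XS X0) //; apply/closed_inP => K e; rewrite !inE.
    move=> /and4P[KC KA KF KS] eK PS.
    have PF : P e K != F.
      apply: contraNneq FC => EF; rewrite -EF; move/closed_inP: cC; apply=> //.
      by rewrite !inE PS EF andbT; apply: contraNneq FA => ->.
    have PX : P e K \in (S :\ F) :\: A.
      by move/closed_inP: cB; apply=> //; rewrite !inE ?PF ?KF ?KA.
    move: (PX); rewrite !inE => -> ; rewrite andbT.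
    move/closed_inP: cC; apply=> //; rewrite !inE PS andbT.
    by apply: contraTneq PX => ->; rewrite !inE GA.
  by rewrite !inE eqxx !andbF.
have [C [CS C0 cC CnS]] := not_dual_connected ncG.
have [FC|/sub] := boolP (F \in C); last exact.
apply: (sub ((S :\ G) :\: C)); rewrite ?subsetDl //.
- by rewrite setD_eq0; apply: contra CnS => H; rewrite eqEsubset CS.
- apply: contraNneq C0 => E; rewrite -finset.subset0; apply/fintype.subsetP => K KC.
  by have := fintype.subsetP CS K KC; rewrite -E inE KC.
- by apply: closed_in_compl => //; apply: subset_trans (subD1set _ _) SZ.
- by rewrite inE FC.
Qed.

(** The existence half of the st-ordering: some triangle adjacent to the outside of [S] can be taken
without disconnecting [S]. *)
Lemma removable S : S \subset Z -> S != Z -> dual_connected Z -> dual_connected S ->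
  S != finset.set0 ->
  exists F e, [/\ F \in S, e \in edges_of F, P e F \notin S & dual_connected (S :\ F)].
Proof.
move=> SZ SnZ cZ cS S0.
have /not_closed_in[F [e [FS eF _ PS]]] : ~~ closed_in Z S.
  by apply: contra SnZ => /(dual_connectedP _ cZ _ SZ S0)->.
have [cF|/not_dual_connected[A [AS A0 cA AnS]]] := boolP (dual_connected (S :\ F)).
  by exists F, e.
exact: (@removable_aux S SZ SnZ cZ cS #|A| F A e).
Qed.

End Pairing.

(** * Every circuit is decoded *)

Section Encoding.
Variable V : finType.
Implicit Types (e F G : {set V}) (A S : {set {set V}}) (D : seq ({set V} * {set V})).
Variables (Z : {set {set V}}) (P : {set V} -> {set V} -> {set V}).
Hypotheses (pairP : pairing Z P) (Z3 : forall F, F \in Z -> #|F| = 3).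
Hypothesis connZ : dual_connected P Z.
Variables (h : V -> nat) (T : nat).
Hypothesis degh : forall y, 3 * #|[set F in Z | y \in F]| <= T * h y.

(** A dart is a triangle together with one of its edges. The open darts of the remaining set [S] point
from [S] through the open edges; the decoder sees their edges only. *)
Definition open_darts S D : Prop :=
  uniq D /\ forall F e, ((F, e) \in D) = [&& F \in S, e \in edges_of F & P e F \notin S].

Definition labels D : seq {set V} := [seq d.2 | d <- D].

(** The guard of the decoder never forbids a closing step of a circuit whose degrees are controlled
by [h]. *)
Lemma count_labels_le S D y : S \subset Z -> open_darts S D ->
  count (fun e => y \in e) (labels D) <= T * h y.
Proof.
move=> SZ [uD memD]; apply: leq_trans (degh y); rewrite count_map -size_filter.
pose L := [seq (F, e) | F <- enum [set F in Z | y \in F], e <- enum (edges_of F)].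
have -> : 3 * #|[set F in Z | y \in F]| = size L.
  rewrite /L size_allpairs_dep sumnE big_map big_enum /= (eq_bigr (fun=> 3)).
    by rewrite sum_nat_const mulnC.
  by move=> F; rewrite inE => /andP[FZ _]; rewrite -cardE card_edges_of // Z3.
apply: uniq_leq_size; first exact: filter_uniq.
move=> [F e]; rewrite mem_filter /= memD => /and4P[ye FS eF _].
apply/allpairsPdep; exists F, e; rewrite !mem_enum inE eF (fintype.subsetP SZ F FS) /=.
by split=> //; move: eF; rewrite mem_edges_of => /andP[/fintype.subsetP/(_ y ye)].
Qed.

Lemma delete_label d D : d \in D ->
  delete_nth (index d D) (labels D) = labels (rem d D).
Proof. by move=> dD; rewrite /delete_nth /labels -map_take -map_drop -map_cat -remE. Qed.

Lemma open_darts_delete S D D' new F : S \subset Z -> F \in S -> 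
  open_darts S D -> uniq D' -> {subset D' <= D} ->
  (forall G e, (G, e) \in D -> ((G, e) \in D') = (G != F)) ->
  uniq new ->
  (forall G e, (G, e) \in new = [&& G \in S, e \in edges_of G & P e G == F]) ->
  open_darts (S :\ F) (new ++ D').
Proof.
move=> SZ FS [uD memD] uD' sub D'E un newE; split.
  rewrite cat_uniq un uD' andbT -all_predC; apply/allP => -[G e] /= /sub.
  rewrite memD newE => /and3P[_ _ PS]; apply: contra PS => /and3P[_ _ /eqP->] //.
move=> G e; rewrite mem_cat newE !inE negb_and negbK.
have notD : (G, e) \notin D -> ((G, e) \in D') = false.
  by move=> GD; apply: contraNF GD; apply: sub.
have [GS|GS] := boolP (G \in S); last first.
  by rewrite notD ?memD ?(negbTE GS) //= andbF.
have [eG|eG] := boolP (e \in edges_of G); last first.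
  by rewrite notD ?memD ?(negbTE eG) ?andbF.
have [PZ _ nP PP] := pairP (fintype.subsetP SZ G GS) eG.
rewrite /=; have [EF|nF] /= := eqVneq (P e G) F; first by rewrite -EF eq_sym nP.
have [PS|PS] := boolP (P e G \in S); last by rewrite D'E ?memD ?GS ?eG ?PS ?andbT.
by rewrite notD ?memD ?PS ?andbF.
Qed.

(** A separating triangle [G] stops being separating when [F] is taken only if [F] was by itself one of
the sides of [G], and then [F] and [G] are neighbours: [G] becomes reachable through the edge just
opened. This is why discarded edges are never needed again. *)
Lemma connected_after_delete S F G : S \subset Z -> dual_connected P S ->
  F \in S -> G \in S -> G != F ->
  dual_connected P ((S :\ F) :\ G) -> dual_connected P (S :\ G) \/
  exists e, e \in edges_of G /\ P e G = F.
Proof.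
move=> SZ cS FS GS GF cSFG.
have [cSG|/not_dual_connected[A [AS A0 cA AnS]]] := boolP (dual_connected P (S :\ G)); [by left|right].
have SGZ : S :\ G \subset Z by apply: subset_trans (subD1set _ _) SZ.
have main (B : {set {set V}}) : B \subset S :\ G -> closed_in P (S :\ G) B -> B != S :\ G ->
    F \in B -> exists e, e \in edges_of G /\ P e G = F.
  move=> BS cB BnS FB.
  have GB : G \notin B by apply/negP => /(fintype.subsetP BS); rewrite !inE eqxx.
  have BF : B :\ F = finset.set0.
    apply: contraNeq BnS => BF0; rewrite -(setD1K FB).
    rewrite ((dual_connectedP _ _ cSFG) (B :\ F)) //.
    - by apply/eqP/setP => H; rewrite !inE; case: (eqVneq H F) => [->|]; rewrite ?FS ?[F == G]eq_sym ?GF.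
    - apply/fintype.subsetP => H; rewrite !inE => /andP[-> /(fintype.subsetP BS)].
      by rewrite !inE.
    apply/closed_inP => H e; rewrite in_setD1 => /andP[_ HB] eH PS.
    move: PS; rewrite !in_setD1 => /and3P[PG PF PS]; rewrite PF /=.
    by move/closed_inP: cB; apply=> //; rewrite in_setD1 PG.
  have : ~~ closed_in P S [set F].
    apply/negP => cF; have /setP/(_ G) : [set F]%SET = S.
      apply: (dual_connectedP _ _ cS) => //; first by rewrite sub1set.
      by apply/set0Pn; exists F; rewrite inE.
    by rewrite GS inE (negbTE GF).
  case/not_closed_in => _ [e [/set1P-> eF PS PF]].
  have [PZ ePF nP PP] := pairP (fintype.subsetP SZ F FS) eF.
  suff E : P e F = G by exists e; rewrite -E.
  apply: contraNeq nP => PG.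
  have : P e F \in B by move/closed_inP: cB; apply=> //; rewrite in_setD1 PG.
  by rewrite -(setD1K FB) BF finset.setU0 inE.
have [FA|FA] := boolP (F \in A); first exact: (main A).
apply: (main ((S :\ G) :\: A)).
- exact: subsetDl.
- exact: (closed_in_compl pairP).
- apply: contraNneq A0 => E; rewrite -finset.subset0; apply/fintype.subsetP => K KA.
  by have := fintype.subsetP AS K KA; rewrite -E inE KA.
- by rewrite !inE FA FS andbT eq_sym.
Qed.

(** [Lv] holds the open darts not discarded yet, [Dd] the discarded ones. The invariant is that every
triangle that is reachable and can be taken without disconnecting [S] is reachable through a
dart in [Lv]; [removable] then makes [Lv] nonempty. Each decision either discards a dart or takes a
triangle, which adds at most one dart to [Lv]; so [size Lv + #|S|.*2] decreases. *)
Theorem decode_complete k : forall S Lv Dd,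
  S \subset Z -> S != Z -> S != finset.set0 -> dual_connected P S ->
  open_darts S (Lv ++ Dd) ->
  (forall F e, F \in S -> e \in edges_of F -> P e F \notin S -> dual_connected P (S :\ F) ->
     exists e', (F, e') \in Lv) ->
  size Lv + #|S|.*2 <= k ->
  exists2 out, out \in decode h T k #|S| (labels (Lv ++ Dd)) & [set F in out] = S.
Proof.
elim: k => [|k IHk] S Lv Dd SZ SnZ S0 cS oD live lek.
  by case/negP: S0; rewrite -cards_eq0; move: lek; clear; lia.
have [cS1|cS1] := eqVneq #|S| 1%N.
  case/eqP/cards1P: cS1 => F SF; have [uD memD] := oD.
  have FZ : F \in Z by apply: (fintype.subsetP SZ); rewrite SF inE.
  have pD : perm_eq (Lv ++ Dd) [seq (F, e) | e <- enum (edges_of F)].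
    apply: uniq_perm => //; first by rewrite map_inj_uniq ?enum_uniq // => ? ? [].
    move=> [G e]; rewrite memD SF inE; apply/idP/mapP.
      by case/and3P=> /eqP-> eF _; exists e; rewrite ?mem_enum.
    case=> e'; rewrite mem_enum => eF [-> ->]; rewrite eqxx eF inE.
    by have [_ _ ->] := pairP FZ eF.
  have pL : perm_eq (labels (Lv ++ Dd)) (enum (edges_of F)).
    rewrite (perm_trans (perm_map _ pD)) // -map_comp map_id_in //.
  have sL : size (labels (Lv ++ Dd)) = 3 by rewrite (perm_size pL) -cardE card_edges_of ?Z3.
  exists [:: F]; last by rewrite SF; apply/setP => G; rewrite !inE.
  have -> : F = \bigcup_(e <- labels (Lv ++ Dd)) e.
    rewrite (perm_big _ pL) /= big_enum /=; apply/setP => x; apply/idP/bigcupP.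
      move=> xF; have /eqP : #|F :\ x| = 2 by have := Z3 FZ; rewrite (cardsD1 x) xF add1n => -[].
      move/cards2P => [y [z [yz E]]].
      have : y \in F :\ x by rewrite E !inE eqxx.
      rewrite !inE => /andP[yx yF]; exists [set x; y]; last by rewrite !inE eqxx.
      rewrite mem_edges_of cards2 [x == y]eq_sym yx andbT.
      by apply/fintype.subsetP => t; rewrite !inE => /orP[]/eqP->.
    by case=> e; rewrite mem_edges_of => /andP[/fintype.subsetP eF _] /eF.
  have := mem_decode_stop h T k.+1; rewrite SF cards1.
  move: sL; case: (labels _) => [|e1 [|e2 [|e3 []]]] //= _ /(_ e1 e2 e3).
  by rewrite !big_cons big_nil finset.setU0.
have [F0 [e0 [FS0 eF0 PS0 cSF0]]] := removable pairP Z3 SZ SnZ connZ cS S0.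
case: Lv oD live lek => [|[F e] Lv] oD live lek.
  by have [] := live F0 e0 FS0 eF0 PS0 cSF0.
have [uD memD] := oD.
have /and3P[FS eF PS] : [&& F \in S, e \in edges_of F & P e F \notin S].
  by rewrite -memD mem_head.
have FZ := fintype.subsetP SZ F FS.
have [cSF|ncSF] := boolP (dual_connected P (S :\ F)); last first.
  have [] := IHk S Lv (rcons Dd (F, e)) SZ SnZ S0 cS.
  - split.
      by rewrite -cats1 catA uniq_catC.
    by move=> G f; rewrite -memD !mem_cat mem_rcons !inE orbCA orbA.
  - move=> G f GS fG PG cG; have [f'] := live G f GS fG PG cG.
    rewrite inE => /orP[/eqP[EG _]|]; last by exists f'.
    by move: ncSF; rewrite -EG cG.
  - exact: lek.
  move=> out Ho So; exists out => //; apply: mem_decode_discard.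
  by move: Ho; rewrite /labels -rcons_cat map_rcons.
(* As [S] is connected, some edge [e'] of [F] stays inside [S]; the remaining edge [e''] decides
   between naming the apex [w] and closing the angle at [y]. *)
have [e' [eF' PS']] : exists e', e' \in edges_of F /\ P e' F \in S.
  have /not_closed_in[G [e' [/set1P-> eF' PS' _]]] : ~~ closed_in P S [set F].
    apply/negP => cF.
    have F0' : [set F]%SET != finset.set0 by apply/set0Pn; exists F; rewrite inE.
    by move: cS1; rewrite -((dual_connectedP _ _ cS) _ _ F0' cF) ?cards1 // sub1set.
  by exists e'.
have ne : e != e' by apply: contraNneq PS => ->.
have [x [y [w [un eE e'E FE]]]] := two_edges (Z3 FZ) eF eF' ne.
set e'' := [set y; w]%SET.
have EF := edges_of_triple un FE.
have eF'' : e'' \in edges_of F by rewrite EF !inE eqxx !orbT.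
move: (un); rewrite /= !inE negb_or => /and3P[/andP[xy xw] yw _].
have we : w \notin e by rewrite eE !inE negb_or ![w == _]eq_sym xw yw.
have nee'' : e != e''.
  by apply/eqP => /setP/(_ x); rewrite eE !inE eqxx (negbTE xy) (negbTE xw).
have ne'e'' : e' != e''.
  by apply/eqP => /setP/(_ x); rewrite e'E !inE eqxx (negbTE xy) (negbTE xw).
have cSr : #|S| = #|S :\ F|.+1 by rewrite (cardsD1 F) FS.
have SFZ : S :\ F \subset Z by apply: subset_trans (subD1set _ _) SZ.
have SFnZ : S :\ F != Z by apply: contraTneq FZ => <-; rewrite !inE eqxx.
have SF0 : S :\ F != finset.set0.
  by rewrite -cards_eq0; move: cS1; rewrite cSr eqSS.
have mem_new f : f \in edges_of F -> P f F \in S -> forall G g,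
    [&& G \in S, g \in edges_of G & P g G == F] -> (g == f) -> (G, g) = (P f F, f).
  move=> fF PfS G g /and3P[GS gG /eqP PG] /eqP gf; rewrite gf in gG PG *.
  by have [_ _ _ PP] := pairP (fintype.subsetP SZ G GS) gG; rewrite -PG PP.
have new_ok f : f \in edges_of F -> P f F \in S ->
    [&& P f F \in S, f \in edges_of (P f F) & P f (P f F) == F].
  by move=> fF PfS; have [_ -> _ ->] := pairP FZ fF; rewrite PfS eqxx.
have new_edge G g : [&& G \in S, g \in edges_of G & P g G == F] -> 
    [/\ g \in edges_of F, P g F \in S & g != e].
  case/and3P=> GS gG /eqP PG.
  have [_ gF _ PP] := pairP (fintype.subsetP SZ G GS) gG.
  rewrite PG in gF PP; rewrite PP; split=> //.
  by apply: contraNneq PS => <-; rewrite PP.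
(* What is common to both kinds of steps: [new] lists the darts opened by taking [F], while
   [Lv'] and [Dd'] are what is left of the old ones. *)
have step new Lv' Dd' : uniq new -> uniq (Lv' ++ Dd') ->
    (forall G g, (G, g) \in new = [&& G \in S, g \in edges_of G & P g G == F]) ->
    {subset Lv' ++ Dd' <= ((F, e) :: Lv) ++ Dd} ->
    (forall G g, (G, g) \in ((F, e) :: Lv) ++ Dd -> ((G, g) \in Lv' ++ Dd') = (G != F)) ->
    (forall G g, (G, g) \in (F, e) :: Lv -> G != F -> (G, g) \in Lv') ->
    size new + size Lv' <= size Lv + 2 ->
    exists2 out, out \in decode h T k #|S :\ F| (labels ((new ++ Lv') ++ Dd')) &
      [set G in out] = S :\ F.
  move=> un' uD' newE sub D'E LvE sz; apply: (IHk (S :\ F) (new ++ Lv') Dd') => //.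
  - by rewrite -catA; apply: (open_darts_delete SZ FS oD).
  - move=> G g; rewrite in_setD1 => /andP[GF GS] gG.
    rewrite in_setD1 negb_and negbK => PG cG.
    have newG f : f \in edges_of G -> P f G = F -> exists g', (G, g') \in new ++ Lv'.
      by move=> fG PfG; exists f; rewrite mem_cat newE GS fG PfG eqxx.
    have [EF'|nPF] := eqVneq (P g G) F; first exact: (newG g).
    rewrite (negbTE nPF) /= in PG.
    have [cG'|[f [fG PfG]]] := connected_after_delete SZ cS FS GS GF cG; last exact: (newG f).
    have [g' Hg'] := live G g GS gG PG cG'.
    by exists g'; rewrite mem_cat LvE ?orbT.
  - by move: sz lek; rewrite size_cat cSr /=; clear; lia.
have [PS''|PS''] := boolP (P e'' F \in S).
  pose new := [seq (P f F, f) | f <- cone_edges w e].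
  have pe : perm_eq (cone_edges w e) [:: e'; e''].
    have pe : perm_eq (enum e) [:: y; x].
      apply: uniq_perm; rewrite ?enum_uniq //= ?inE 1?eq_sym ?xy // => t.
      by rewrite mem_enum eE !inE orbC.
    rewrite /cone_edges (perm_trans (perm_map _ pe)) //= eE e'E.
    have -> : w |: ([set x; y] :\ y) = [set x; w].
      by apply/setP => t; rewrite !inE; case: (eqVneq t y) => [->|];
        rewrite ?(negbTE yw) ?[y == x]eq_sym ?(negbTE xy) /= ?orbF 1?orbC.
    have -> // : w |: ([set x; y] :\ x) = e''.
    by apply/setP => t; rewrite !inE; case: (eqVneq t x) => [->|];
      rewrite ?(negbTE xw) ?(negbTE xy) /= 1?orbC.
  have mem_cone f : f \in cone_edges w e = (f == e') || (f == e'').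
    by rewrite (perm_mem pe) !inE.
  have F_noD G g : (G, g) \in Lv ++ Dd -> G != F.
    move=> GD; have := memD G g; rewrite mem_cat inE -orbA -mem_cat GD orbT.
    move=> /esym/and3P[GS gG PG]; apply/eqP => EG; rewrite {}EG in GD GS gG PG.
    move: gG; rewrite EF !inE -eE -e'E -/e'' -orbA => /or3P[] /eqP Eg; rewrite {}Eg in GD PG.
    - by move: uD; rewrite /= GD.
    - by rewrite PS' in PG.
    - by rewrite PS'' in PG.
  have [] := step new Lv Dd.
  - by rewrite map_inj_uniq ?(perm_uniq pe) /= ?inE ?ne'e'' // => ? ? [].
  - by move: uD => /= /andP[].
  - move=> G g; apply/mapP/idP => [[f]|H].
      rewrite mem_cone => /orP[]/eqP-> [-> ->]; exact: new_ok.
    have [gF PgF nge] := new_edge G g H.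
    move: gF; rewrite EF !inE -eE -e'E -/e'' (negbTE nge) /= => /orP[]gE.
      by exists e'; rewrite ?mem_cone ?eqxx //; exact: mem_new.
    by exists e''; rewrite ?mem_cone ?eqxx ?orbT //; exact: mem_new.
  - by move=> d; rewrite /= inE orbC => ->.
  - move=> G g; rewrite /= inE => /orP[/eqP[-> _]|H]; last by rewrite H (F_noD G g).
    by rewrite eqxx; apply/negP => /F_noD; rewrite eqxx.
  - by move=> G g; rewrite inE => /orP[/eqP[-> _]|]; rewrite ?eqxx.
  - by rewrite size_map (perm_size pe) addnC.
  move=> out Ho So; exists (F :: out); last first.
    by rewrite finset.set_cons So setD1K.
  have labE : labels ((new ++ Lv) ++ Dd) = cone_edges w e ++ labels (Lv ++ Dd).
    by rewrite /labels /new -catA map_cat -map_comp map_id_in.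
  rewrite labE in Ho; have := mem_decode_cone we Ho.
  by rewrite -cSr eE -FE.
pose d := (F, e''); pose new := [:: (P e' F, e')].
have dD : d \in Lv ++ Dd.
  have : d \in ((F, e) :: Lv) ++ Dd by rewrite memD FS eF'' PS''.
  by rewrite /= inE xpair_eqE eqxx eq_sym (negbTE nee'').
have uLD : uniq (Lv ++ Dd) by move: uD => /= /andP[].
have F_noD G g : (G, g) \in Lv ++ Dd -> (G, g) != d -> G != F.
  move=> GD gd; have := memD G g; rewrite mem_cat inE -orbA -mem_cat GD orbT.
  move=> /esym/and3P[GS gG PG]; apply/eqP => EG; rewrite {}EG in GD GS gG PG gd.
  move: gG; rewrite EF !inE -eE -e'E -/e'' -orbA => /or3P[] /eqP Eg; rewrite {}Eg in GD PG gd.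
  - by move: uD; rewrite /= GD.
  - by rewrite PS' in PG.
  - by rewrite /d eqxx in gd.
have [Lv' [Dd' [remE' LvE szL]]] : exists Lv' Dd', [/\ rem d (Lv ++ Dd) = Lv' ++ Dd',
    (forall c, c \in Lv -> c != d -> c \in Lv') & size Lv' <= size Lv].
  exists [seq c <- Lv | c != d], [seq c <- Dd | c != d]; split.
  - by rewrite rem_filter // filter_cat.
  - by move=> c cL cd; rewrite mem_filter cd.
  - by rewrite size_filter count_size.
have uLD' : uniq (Lv' ++ Dd') by rewrite -remE' rem_uniq.
have memLD c : (c \in Lv' ++ Dd') = (c != d) && (c \in Lv ++ Dd).
  by rewrite -remE' mem_rem_uniq // inE.
have [] := step new Lv' Dd' isT uLD'.
- move=> G g; rewrite inE; apply/eqP/idP => [[-> ->]|H]; first exact: new_ok.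
  have [gF PgF nge] := new_edge G g H; apply: mem_new => //.
  move: gF; rewrite EF !inE -eE -e'E -/e'' (negbTE nge) /= => /orP[]// /eqP ge.
  by rewrite ge (negbTE PS'') in PgF.
- by move=> c; rewrite memLD /= inE => /andP[_ ->]; rewrite orbT.
- move=> G g; rewrite memLD /= inE => /orP[/eqP[-> ->]|H].
    by rewrite eqxx; apply/negP => /andP[_ H]; move: uD; rewrite /= H.
  rewrite H andbT; have [E|nd] := eqVneq (G, g) d; last by rewrite (F_noD G g).
  by case: E => -> _; rewrite eqxx.
- move=> G g; rewrite inE => /orP[/eqP[-> _]|H GF]; first by rewrite eqxx.
  by apply: LvE => //; apply: contraNneq GF => -[->].
- by rewrite /= add1n addn2 ltnS; apply: leq_trans szL _.
move=> out Ho So; exists (F :: out); last by rewrite finset.set_cons So setD1K.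
have ltd : index d (Lv ++ Dd) < size (labels (Lv ++ Dd)) by rewrite size_map index_mem.
have nthd : nth finset.set0 (labels (Lv ++ Dd)) (index d (Lv ++ Dd)) = e''.
  by rewrite (nth_map d) ?index_mem // nth_index.
have eI : e :&: e'' = [set y].
  apply/setP => t; rewrite eE !inE; case: (eqVneq t y) => [->|ty]; first by rewrite orbT.
  by rewrite orbF /=; case: (eqVneq t x) => [->|]//=; rewrite (negbTE xw).
have eD : symdiff e e'' = e'.
  apply/setP => t; rewrite /symdiff eE e'E /e'' !inE.
  case: (eqVneq t x) => [->|tx]; first by rewrite (negbTE xy) (negbTE xw).
  case: (eqVneq t y) => [->|ty]; first by rewrite (negbTE yw).
  by case: (t == w).
have FE' : F = e :|: e''.
  by rewrite FE eE; apply/setP => t; rewrite !inE; do 3!case: (t == _).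
have cy := count_labels_le y SZ oD.
have := @mem_decode_close _ h T k #|S :\ F| e (labels (Lv ++ Dd)) (index d (Lv ++ Dd)) y out ltd.
rewrite nthd -FE' eI eD delete_label // remE' -cSr; apply=> //.
by apply: leq_trans cy; rewrite /= leq_addl.
Qed.

Lemma circuit_decoded F : F \in Z -> 1 < #|Z| ->
  exists2 out, out \in decode h T (#|Z|.*2.+1) #|Z|.-1 (enum (edges_of F)) &
     [set G in F :: out] = Z.
Proof.
move=> FZ Z1.
have cZr : #|Z| = #|Z :\ F|.+1 by rewrite (cardsD1 F) FZ.
have pD : open_darts (Z :\ F) ([seq (P e F, e) | e <- enum (edges_of F)] ++ [::]).
  rewrite cats0; split; first by rewrite map_inj_uniq ?enum_uniq // => ? ? [].
  move=> G e; rewrite !in_setD1 negb_and negbK; apply/mapP/idP.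
    case=> f; rewrite mem_enum => fF [-> ->].
    by have [-> -> -> ->] := pairP FZ fF; rewrite eqxx.
  case/and3P=> /andP[GF GZ] eG; have [PZ ePF _ PP] := pairP GZ eG.
  rewrite PZ orbF => /eqP PF; rewrite PF in ePF PP.
  by exists e; rewrite ?mem_enum ?PP.
have [] := @decode_complete (#|Z|.*2.+1) (Z :\ F) _ [::] (subD1set _ _) _ _ _ pD.
- by apply: contraTneq FZ => <-; rewrite !inE eqxx.
- by rewrite -cards_eq0; move: Z1; rewrite cZr; lia.
- exact: connected_delete.
- move=> G e; rewrite in_setD1 => /andP[GF GZ] eG; have [PZ ePF _ PP] := pairP GZ eG.
  rewrite in_setD1 PZ andbT negbK => /eqP PF _; rewrite PF in ePF PP.
  by exists e; apply/mapP; exists e; rewrite ?mem_enum ?PP.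
- by rewrite size_map -cardE card_edges_of ?Z3 // cZr; lia.
move=> out; rewrite cats0 /labels -map_comp map_id_in // => Ho So.
exists out; first by have -> : #|Z|.-1 = #|Z :\ F| by rewrite cZr.
by rewrite finset.set_cons So setD1K.
Qed.

End Encoding.

(** * The number of circuits *)

Section Counting.
Variable V : finType.
Implicit Types (e F : {set V}) (Z : {set {set V}}).

Definition face_degree Z y := #|[set F in Z | y \in F]|.

Lemma sum_face_degree Z : (forall F, F \in Z -> #|F| = 3) ->
  \sum_y face_degree Z y = 3 * #|Z|.
Proof.
move=> Z3; rewrite (eq_bigr (fun y => \sum_(F in Z | y \in F) 1)); last first.
  by move=> y _; rewrite /face_degree -sum1_card; apply: eq_bigl => F; rewrite inE.
rewrite (exchange_big_dep (mem Z)) /=; last by move=> y F _ /andP[].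
rewrite (eq_bigr (fun=> 3)) ?sum_nat_const 1?mulnC // => F FZ.
by rewrite -(Z3 F FZ) -sum1_card; apply: eq_bigl => y; rewrite FZ.
Qed.

(** The function [h], stored as the list of the degrees of the vertices of high degree; all other
vertices get the value 1. *)
Definition profile f K (t : K.-tuple (V * 'I_f.+1)) (y : V) : nat :=
  maxn 1 (head 1 [seq nat_of_ord d.2 | d <- t & d.1 == y]).

(** The degrees sum to [3 * f], so at most [3 * f %/ T0] of them reach [T0]. The remaining ones
are below [T0], so the value 1 is off by a factor of at most [T0]. *)
Lemma profile_exists Z f T0 : (forall F, F \in Z -> #|F| = 3) -> Z != finset.set0 ->
  #|Z| = f -> 0 < T0 ->
  exists t : (3 * f %/ T0).-tuple (V * 'I_f.+1),
    \sum_y profile t y <= #|V| + 3 * f /\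
    forall y, 3 * face_degree Z y <= 3 * T0 * profile t y.
Proof.
move=> Z3 Z0 cZ T0_gt0.
have degf y : face_degree Z y <= f.
  by rewrite -cZ subset_leq_card //; apply/fintype.subsetP => F; rewrite inE => /andP[].
pose heavy := [set y | T0 <= face_degree Z y].
have heavyK : #|heavy| <= 3 * f %/ T0.
  rewrite leq_divRL // -cZ -sum_face_degree // -sum_nat_const.
  rewrite [leqRHS](bigID (mem heavy)) /=; apply: leq_trans (leq_addr _ _).
  by apply: leq_sum => y; rewrite inE.
have [F FZ] : exists F, F \in Z by apply/set0Pn.
have [v0 _] : exists v, v \in F by apply/set0Pn; rewrite -card_gt0 Z3.
pose L := [seq (y, inord (face_degree Z y) : 'I_f.+1) | y <- enum heavy] ++
          nseq (3 * f %/ T0 - #|heavy|) (v0, inord 1 : 'I_f.+1).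
have sL : size L == 3 * f %/ T0.
  by rewrite size_cat size_map size_nseq -cardE subnKC.
have profE y : profile (Tuple sL) y = if y \in heavy then face_degree Z y else 1.
  rewrite /profile /= /L filter_cat filter_map /= map_cat -map_comp /=.
  case: ifP => yh.
    rewrite (eq_filter (a2 := pred1 y)) //.
    rewrite filter_pred1_uniq ?enum_uniq ?mem_enum //= inordK ?ltnS //.
    by apply/maxn_idPr; move: yh; rewrite inE; apply: leq_trans.
  rewrite (eq_in_filter (a2 := pred0)); last first.
    by move=> z /=; rewrite mem_enum => zh; apply/negbTE; apply: contraFneq yh => <-.
  rewrite filter_pred0 /= filter_nseq map_nseq; case: (_ * _) => [|m] /=; first exact: maxnn.
  have f_gt0 : 0 < f by rewrite -cZ card_gt0.
  by rewrite inordK.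
exists (Tuple sL); split.
  have -> : #|V| + 3 * f = \sum_y (1 + face_degree Z y).
    by rewrite big_split /= sum1_card sum_face_degree // cZ.
  apply: leq_sum => y _.
  by rewrite profE; case: ifP => _; rewrite ?leq_addl ?leq_addr.
move=> y; rewrite profE; case: ifP => yh.
  by rewrite -mulnA leq_mul2l leq_pmull.
by rewrite muln1 leq_mul2l ltnW // ltnNge; move: yh; rewrite inE => ->.
Qed.

Local Open Scope ring_scope.

Lemma state_weight_triple (R : realFieldType) (g : V -> R) (s : R) x y w : 0 < s ->
  uniq [:: x; y; w] ->
  state_weight g s (enum (edges_of (w |: [set x; y]))) =
    g x ^+ 2 * g y ^+ 2 * g w ^+ 2 / s ^+ 3.
Proof.
move=> s0 un; have EF := edges_of_triple un erefl.
move: (un); rewrite /= !inE negb_or => /and3P[/andP[xy xw] yw _].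
have c3 : #|w |: [set x; y]| = 3%N.
  by rewrite cardsU1 !inE cards2 xy negb_or ![w == _]eq_sym xw yw.
have pe : perm_eq (enum (edges_of (w |: [set x; y])))
    [:: [set x; y]%SET; [set x; w]%SET; [set y; w]%SET].
  have mem z : z \in [:: [set x; y]%SET; [set x; w]%SET; [set y; w]%SET] =
      (z \in edges_of (w |: [set x; y])) by rewrite EF !inE orbA.
  apply: uniq_perm; rewrite ?enum_uniq //; last by move=> z; rewrite mem_enum mem.
  by apply/card_uniqP; rewrite (eq_card mem) card_edges_of.
rewrite /state_weight (perm_big _ pe) !big_cons big_nil /edge_weight.
rewrite !big_setU1 ?inE //= !big_set1.
by field; rewrite gt_eqF.
Qed.

(** The first triangle is named by an ordered triple of vertices, so that the sum of its weights
factors as the cube of the sum of [h]. *)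
Definition start_outputs f T (h : V -> nat) : seq (seq {set V}) :=
  flatten [seq [seq (p.1.1 |: [set p.1.2; p.2]) :: out
      | out <- decode h T (f.*2.+1) f.-1 (enum (edges_of (p.1.1 |: [set p.1.2; p.2])))]
    | p <- [seq p <- enum {: V * V * V} | uniq [:: p.1.2; p.2; p.1.1]]].

Lemma size_start_outputs (R : rcfType) f T (h : V -> nat) : (0 < f)%N ->
  (forall x, (0 < h x)%N) -> (\sum_y h y <= #|V| + 3 * f)%N ->
  (size (start_outputs f T h))%:R <=
    (3 + 2 * T%:R) ^+ (f.*2.+2) * Num.sqrt (#|V| + 3 * f)%:R ^+ (f + 4)%N :> R.
Proof.
move=> f_gt0 h_gt0 sumh.
pose g x : R := Num.sqrt (h x)%:R; pose s : R := Num.sqrt (#|V| + 3 * f)%:R.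
have s0 : 0 < s by rewrite sqrtr_gt0 ltr0n addn_gt0 muln_gt0 f_gt0 orbT.
have gE x : g x ^+ 2 = (h x)%:R by rewrite sqr_sqrtr.
have g1 x : 1 <= g x.
  by rewrite /g -[leLHS]sqrtr1 ler_wsqrtr // ler1n.
have g0 x : 0 < g x by apply: lt_le_trans (g1 x).
have sE : s ^+ 2 = (#|V| + 3 * f)%:R by rewrite sqr_sqrtr.
have sumg : \sum_x g x ^+ 2 <= s ^+ 2.
  by rewrite sE (eq_bigr _ (fun x _ => gE x)) -natr_sum ler_nat.
rewrite -/s /start_outputs sum_size_flatten big_filter big_enum_cond /=.
set A := (_ + _ : R).
have A0 : 0 <= A by rewrite /A addr_ge0 // mulr_ge0.
have sG := ltW s0; have G0 x : 0 <= g x ^+ 2 by rewrite gE.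
have C0 : 0 <= A ^+ (f.*2.+2) * s ^+ (f.-1 + 2)%N / s ^+ 3.
  by apply: divr_ge0; [apply: mulr_ge0|]; apply: exprn_ge0.
apply: (@le_trans _ _ (\sum_(p : V * V * V)
    A ^+ (f.*2.+2) * s ^+ (f.-1 + 2)%N / s ^+ 3 *
    (g p.1.1 ^+ 2 * (g p.1.2 ^+ 2 * g p.2 ^+ 2)))).
  rewrite big_mkcond /=; apply: ler_sum => -[[w x] y] _ /=.
  case: ifP => un; last by rewrite mulr_ge0 // mulr_ge0 // mulr_ge0.
  have c2 : all (fun e => #|e| == 2%N) (enum (edges_of (w |: [set x; y]))).
    by apply/allP => e; rewrite mem_enum mem_edges_of => /andP[].
  rewrite size_map.
  have H := size_decode_le g0 s0 T gE g1 sumg f.*2.+1 f.-1 c2.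
  apply: (le_trans H).
  rewrite state_weight_triple // -/A le_eqVlt; apply/orP; left; apply/eqP.
  by field; rewrite gt_eqF.
rewrite -mulr_sumr.
have -> : \sum_(p : V * V * V) g p.1.1 ^+ 2 * (g p.1.2 ^+ 2 * g p.2 ^+ 2) =
    (\sum_x g x ^+ 2) ^+ 3.
  rewrite -(pair_bigA _ (fun q y => g q.1 ^+ 2 * (g q.2 ^+ 2 * g y ^+ 2))) /=.
  rewrite -(pair_bigA _ (fun x z => \sum_y g x ^+ 2 * (g z ^+ 2 * g y ^+ 2))) /=.
  rewrite exprS expr2 !mulr_suml; apply: eq_bigr => x _.
  rewrite mulr_sumr; apply: eq_bigr => z _.
  by rewrite mulr_sumr mulr_sumr.
have -> : A ^+ (f.*2.+2) * s ^+ (f + 4)%N =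
   A ^+ (f.*2.+2) * s ^+ (f.-1 + 2)%N / s ^+ 3 * (s ^+ 2) ^+ 3.
  have -> : (f + 4 = (f.-1 + 2) + 3)%N by lia.
  by rewrite -exprM [s ^+ (_ + 3)]exprD; field; rewrite gt_eqF.
rewrite ler_wpM2l // lerXn2r // nnegrE; first exact: sumr_ge0.
exact: exprn_ge0.
Qed.

Lemma circuit_card_gt1 Z : circuit Z -> (1 < #|Z|)%N.
Proof.
move=> cZ; have /andP[evZ Z0] := minsetp cZ.
have [Z3 _] := even_familyP _ evZ.
have [P pairP] := pairing_exists evZ.
have [F FZ] : exists F, F \in Z by apply/set0Pn.
have [e eF] : exists e, e \in edges_of F.
  by apply/set0Pn; rewrite -card_gt0 card_edges_of ?Z3.
have [PZ _ nP _] := pairP _ _ FZ eF.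
rewrite (cardsD1 F) FZ (cardsD1 (P e F)) !inE nP PZ //.
Qed.

(** The square root raised to [f + 4] is the factor [M^(f/2 + 2)]: one [M] for each of about [f/2] named
apices, and the rest from the first triangle. *)
Theorem count_circuits (R : rcfType) f T0 : (0 < f)%N -> (0 < T0)%N ->
  (#|[set Z : {set {set V}} | circuit Z & #|Z| == f]|)%:R <=
    (#|V| * f.+1)%:R ^+ (3 * f %/ T0)%N *
    ((3 + 6 * T0%:R) ^+ (f.*2.+2) * Num.sqrt (#|V| + 3 * f)%:R ^+ (f + 4)%N) :> R.
Proof.
move=> f0 T00; set K := (3 * f %/ T0)%N; set B := (X in _ <= _ * X).
pose good := [seq t <- enum {: K.-tuple (V * 'I_f.+1)} |
   (\sum_y profile t y <= #|V| + 3 * f)%N].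
pose outs := flatten [seq start_outputs f (3 * T0) (profile t) | t <- good].
have sub : [set Z : {set {set V}} | circuit Z & #|Z| == f] \subset
    [seq [set F in out] | out <- outs].
  apply/fintype.subsetP => Z; rewrite inE => /andP[cZ /eqP cardZ].
  have /andP[evZ Z0] := minsetp cZ.
  have [Z3 _] := even_familyP _ evZ.
  have [P pairP] := pairing_exists evZ.
  have [t [sumt degt]] := profile_exists Z3 Z0 cardZ T00.
  have [F FZ] : exists F, F \in Z by apply/set0Pn.
  have [out outP outE] := circuit_decoded pairP Z3 (circuit_connected pairP Z3 cZ) degt
    FZ (circuit_card_gt1 cZ).
  apply/mapP; exists (F :: out) => //.
  apply/flatten_mapP; exists t; first by rewrite mem_filter sumt mem_enum.
  have c3 := Z3 F FZ.
  have /card_gt1P[e [e' [eF eF' ne]]] : (1 < #|edges_of F|)%N by rewrite card_edges_of.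
  have [x [y [w [un _ _ FE]]]] := two_edges c3 eF eF' ne.
  apply/flatten_mapP; exists ((w, x), y); first by rewrite mem_filter un mem_enum.
  rewrite cardZ in outP.
  by apply/mapP; exists out; rewrite -[(w, x, y).1.1]/w -[(w, x, y).1.2]/x -[(w, x, y).2]/y -FE.
have leR : (#|[set Z : {set {set V}} | circuit Z & #|Z| == f]| <= size outs)%N.
  by rewrite (leq_trans (subset_leq_card sub)) // (leq_trans (card_size _)) ?size_map.
apply: (@le_trans _ _ (size outs)%:R); first by rewrite ler_nat.
rewrite /outs sum_size_flatten.
apply: (@le_trans _ _ (\sum_(t <- good) B)).
  rewrite big_seq [leRHS]big_seq; apply: ler_sum => t; rewrite mem_filter => /andP[sumt _].
  have h_gt0 x : (0 < profile t x)%N by rewrite leq_maxl.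
  rewrite (le_trans (size_start_outputs R (3 * T0) f0 h_gt0 sumt)) // /B.
  by have -> : 3 + 2 * (3 * T0)%:R = 3 + 6 * T0%:R :> R by rewrite natrM; ring.
have B0 : 0 <= B by rewrite mulr_ge0 ?exprn_ge0 ?sqrtr_ge0 // addr_ge0 // mulr_ge0.
rewrite big_const_seq iter_addr_0 count_predT -[leLHS]mulr_natl ler_wpM2r //.
rewrite -natrX ler_nat size_filter (leq_trans (count_size _ _)) // -cardE.
by rewrite card_tuple card_prod card_ord.
Qed.

End Counting.

(** * Random colouring and deletion *)

Local Open Scope ring_scope.

Section Deletion.
Variables (R : realFieldType) (I : finType).
Implicit Types (B U Y : {set I}).

(** The colours of distinct points are independent: expand the product over the points. *)
Lemma sum_colourings q B :
  \sum_(c : {ffun I -> 'I_q.+1}) ([forall i in B, c i == ord0])%:R =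
    q.+1%:R ^+ #|I| / q.+1%:R ^+ #|B| :> R.
Proof.
transitivity (\sum_(c : {ffun I -> 'I_q.+1})
    \prod_i (if i \in B then (c i == ord0)%:R else 1) : R).
  apply: eq_bigr => c _; case: forall_inP => [cB|/forall_inP].
    by rewrite big1 // => i _; case: ifP => // /cB/eqP->; rewrite eqxx.
  rewrite negb_forall_in => /exists_inP[i iB ci].
  by rewrite (bigD1 i) //= iB (negbTE ci) mul0r.
rewrite -(bigA_distr_bigA (fun i j => if i \in B then (j == ord0)%:R else 1)) /=.
transitivity (\prod_(i : I) (if i \in B then 1 else q.+1%:R) : R).
  apply: eq_bigr => i _; case: ifP => _; last by rewrite sumr_const card_ord.
  by rewrite (bigD1 ord0) //= big1 ?addr0 // => j /negbTE->.
transitivity (\prod_(i in ~: B) (q.+1%:R : R)).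
  by rewrite [RHS]big_mkcond; apply: eq_bigr => i _; rewrite inE; case: ifP.
rewrite prodr_const -(cardsC B) exprD mulrAC divff ?mul1r //.
by rewrite expf_neq0 // pnatr_eq0.
Qed.

(** Alteration: in a uniform colouring with [q] colours, the average of the number of points of [U] of
colour 0 minus the number of bad sets of colour 0 is the left-hand side. Take a colouring which
attains it and remove one point from each of its bad sets. *)
Lemma deletion_method U (Bad : {set {set I}}) (q : nat) : (0 < q)%N ->
  finset.set0 \notin Bad ->
  exists Y, [/\ Y \subset U, forall B, B \in Bad -> ~~ (B \subset Y) &
    #|U|%:R / q%:R - \sum_(B in Bad) (q%:R ^+ #|B|)^-1 <= #|Y|%:R :> R].
Proof.
case: q => // q _ Bad0.
pose E : R := #|U|%:R / q.+1%:R - \sum_(B in Bad) (q.+1%:R ^+ #|B|)^-1.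
pose X (c : {ffun I -> 'I_q.+1}) := [set i in U | c i == ord0].
pose bad (c : {ffun I -> 'I_q.+1}) := [set B in Bad | [forall i in B, c i == ord0]].
have [c Ec] : exists c, E <= #|X c|%:R - #|bad c|%:R.
  case: (pickP (fun c => E <= #|X c|%:R - #|bad c|%:R)) => [c|noc]; first by exists c.
  have : \sum_(c : {ffun I -> 'I_q.+1}) (#|X c|%:R - #|bad c|%:R) <
         \sum_(c : {ffun I -> 'I_q.+1}) E.
    apply: ltr_sum; first by apply/hasP; exists [ffun=> ord0]; rewrite ?mem_index_enum.
    by move=> c _; rewrite ltNge noc.
  rewrite sumr_const card_ffun card_ord sumrB.
  have -> : \sum_(c : {ffun I -> 'I_q.+1}) (#|X c|%:R : R) =
      \sum_(i in U) \sum_(c : {ffun I -> 'I_q.+1}) ([forall j in [set i], c j == ord0])%:R.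
    rewrite exchange_big /=; apply: eq_bigr => c _.
    have -> : #|X c|%:R = \sum_(i in U | c i == ord0) 1 :> R.
      by rewrite -sum1_card natr_sum; apply: eq_bigl => i; rewrite inE.
    rewrite big_mkcondr /=; apply: eq_bigr => i _.
    have -> : [forall j in [set i], c j == ord0] = (c i == ord0).
      by apply/forall_inP/idP => [|ci j /set1P->//]; apply; rewrite inE.
    by case: ifP.
  have -> : \sum_(c : {ffun I -> 'I_q.+1}) (#|bad c|%:R : R) =
      \sum_(B in Bad) \sum_(c : {ffun I -> 'I_q.+1}) ([forall j in B, c j == ord0])%:R.
    rewrite exchange_big /=; apply: eq_bigr => c _.
    have -> : #|bad c|%:R = \sum_(B in Bad | [forall i in B, c i == ord0]) 1 :> R.
      by rewrite -sum1_card natr_sum; apply: eq_bigl => B; rewrite inE.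
    by rewrite big_mkcondr /=; apply: eq_bigr => B _; case: ifP.
  rewrite (eq_bigr (fun=> q.+1%:R ^+ #|I| / q.+1%:R)); last first.
    by move=> i _; rewrite sum_colourings cards1.
  rewrite [X in _ - X](eq_bigr (fun B => q.+1%:R ^+ #|I| * (q.+1%:R ^+ #|B|)^-1)); last first.
    by move=> B _; rewrite sum_colourings.
  rewrite sumr_const -mulr_sumr -[X in _ < X]mulr_natl natrX -[X in X - _]mulr_natl.
  set S := \sum_(B in Bad) _; set Q := q.+1%:R ^+ _.
  suff -> : #|U|%:R * (Q / q.+1%:R) - Q * S = Q * E by rewrite ltxx.
  by rewrite /E -/S; ring.
pose D := [set i | Some i \in [set [pick i in B] | B : {set I} in bad c]].
exists (X c :\: D); split.
- by apply/fintype.subsetP => i; rewrite !inE => /and3P[].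
- move=> B BBad; apply/negP => /fintype.subsetP BY.
  have Bc : B \in bad c.
    by rewrite inE BBad; apply/forall_inP => i /BY; rewrite !inE => /and3P[].
  case pB : [pick i in B] => [i|].
    have iB : i \in B by move: pB; case: pickP => // j jB [<-].
    have := BY i iB; rewrite inE => /andP[/negP[]].
    by rewrite inE; apply/imsetP; exists B; rewrite ?pB.
  move: pB; case: pickP => // B0 _; move: Bad0.
  suff <- : B = finset.set0 by rewrite BBad.
  by apply/setP => i; rewrite inE; exact: B0.
- have DX : (#|D| <= #|bad c|)%N.
    apply: leq_trans (leq_imset_card (fun B => [pick i in B]) _).
    rewrite -(card_imset (mem D) Some_inj); apply: subset_leq_card.
    by apply/fintype.subsetP => _ /imsetP[i iD ->]; rewrite inE in iD.
  rewrite (le_trans Ec) // lerBlDr -natrD ler_nat.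
  apply: leq_trans (leq_add (leqnn _) DX).
  rewrite addnC -leq_subLR cardsD leq_sub2l //.
  by rewrite subset_leq_card // subsetIr.
Qed.

End Deletion.

Lemma sqr_le_exp2 f : (f ^ 2 <= 2 * 2 ^ f)%N.
Proof.
do 3!(case: f => [//|f]).
elim: f => [//|f IH]; rewrite [(2 ^ f.+4)%N]expnS mulnCA.
by apply: leq_trans (leq_mul (leqnn 2) IH); rewrite -!mulnn; nia.
Qed.

Lemma sum_half_le (R : realFieldType) M : \sum_(1 <= f < M.+1) (2^-1 : R) ^+ f <= 1.
Proof.
suff -> : \sum_(1 <= f < M.+1) (2^-1 : R) ^+ f = 1 - 2^-1 ^+ M.
  by rewrite lerBlDr lerDl exprn_ge0 // invr_ge0.
elim: M => [|M IH]; first by rewrite big_geq // expr0 subrr.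
by rewrite big_nat_recr //= IH exprS; field.
Qed.

(** The expected number of surviving circuits with [f] triangles, when triangles survive with
probability [q^-1]. As [n + 3 f] is at most four times the larger of [n] and [f], the square root
contributes [16 * (n^2 + f^2) * (2 * s)^f]; the constant 8 makes all [f]-th powers together at most
[4^-f], and half of that absorbs [f^2]. *)
Lemma count_term_le (R : rcfType) (n f T0 : nat) (q c s : R) :
  (0 < n)%N -> (0 < f)%N -> (f < n ^ 2)%N -> (0 < T0)%N ->
  n%:R ^+ (3 * (3 * f %/ T0))%N <= c ^+ f ->
  Num.sqrt n%:R <= s -> Num.sqrt f%:R <= s ->
  0 < c -> 0 < q -> 8 * (3 + 6 * T0%:R) ^+ 4 * c * s <= q ->
  (n * f.+1)%:R ^+ (3 * f %/ T0)%N *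
    ((3 + 6 * T0%:R) ^+ (f.*2.+2) * Num.sqrt (n + 3 * f)%:R ^+ (f + 4)%N) / q ^+ f
  <= 48 * n%:R ^+ 2 * 2^-1 ^+ f.
Proof.
move=> n0 f0 fn T00 cf ns fs c0 q0 qs; set A := 3 + 6 * T0%:R in qs *.
have A1 : 1 <= A by rewrite /A; have : 0 <= T0%:R :> R by []; lra.
have A0 : 0 < A by apply: lt_le_trans A1.
have s0 : 0 <= s by apply: le_trans fs; exact: sqrtr_ge0.
have H1 : (n * f.+1)%:R ^+ (3 * f %/ T0)%N <= c ^+ f :> R.
  apply: le_trans cf; rewrite exprM; apply: lerXn2r; rewrite ?nnegrE ?exprn_ge0 //.
  by rewrite -natrX ler_nat [(n ^ 3)%N]expnS leq_mul2l fn orbT.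
have H2 : A ^+ (f.*2.+2) <= (A ^+ 4) ^+ f.
  by rewrite -exprM ler_weXn2l //; move: f0; clear; lia.
have H3 : Num.sqrt (n + 3 * f)%:R ^+ (f + 4)%N <=
   16 * (n%:R ^+ 2 + f%:R ^+ 2) * (2 * s) ^+ f :> R.
  have main m : (n + 3 * f <= 4 * m)%N -> Num.sqrt m%:R <= s ->
     Num.sqrt (n + 3 * f)%:R ^+ (f + 4)%N <= 16 * m%:R ^+ 2 * (2 * s) ^+ f :> R.
    move=> le4 ms.
    have le2 : Num.sqrt (n + 3 * f)%:R <= 2 * Num.sqrt m%:R :> R.
      have -> : 2 = Num.sqrt (2 ^+ 2) :> R by rewrite sqrtr_sqr ger0_norm.
      by rewrite -sqrtrM ?exprn_ge0 // ler_wsqrtr // -natrX -natrM ler_nat.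
    have e4 : (2 * Num.sqrt m%:R) ^+ 4 = 16 * m%:R ^+ 2 :> R.
      rewrite exprMn -[4%N]/(2 * 2)%N [Num.sqrt _ ^+ _]exprM sqr_sqrtr //; ring.
    rewrite exprD mulrC -e4; apply: ler_pM; rewrite ?exprn_ge0 ?sqrtr_ge0 //.
      by apply: lerXn2r; rewrite // nnegrE ?mulr_ge0 ?sqrtr_ge0.
    apply: lerXn2r; rewrite ?nnegrE ?mulr_ge0 ?sqrtr_ge0 //.
    by rewrite (le_trans le2) // ler_wpM2l.
  have [nf|fn'] := leqP n f.
    apply: (le_trans (main f _ fs)); first by move: nf; clear; lia.
    by rewrite ler_wpM2r ?exprn_ge0 ?mulr_ge0 // ler_wpM2l // lerDr exprn_ge0.
  apply: (le_trans (main n _ ns)); first by move: fn'; clear; lia.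
  by rewrite ler_wpM2r ?exprn_ge0 ?mulr_ge0 // ler_wpM2l // lerDl exprn_ge0.
have H4 : (n * f.+1)%:R ^+ (3 * f %/ T0)%N *
    (A ^+ (f.*2.+2) * Num.sqrt (n + 3 * f)%:R ^+ (f + 4)%N) / q ^+ f <=
    16 * (n%:R ^+ 2 + f%:R ^+ 2) * (4^-1) ^+ f.
  rewrite ler_pdivrMr ?exprn_gt0 //.
  apply: (@le_trans _ _ (c ^+ f * ((A ^+ 4) ^+ f * (16 * (n%:R ^+ 2 + f%:R ^+ 2) * (2 * s) ^+ f)))).
    have P1 : 0 <= A ^+ (f.*2.+2) by apply: exprn_ge0; apply: ltW.
    have P2 : 0 <= Num.sqrt (n + 3 * f)%:R ^+ (f + 4)%N :> R.
      by apply: exprn_ge0; apply: sqrtr_ge0.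
    apply: ler_pM => //; [exact: exprn_ge0|exact: mulr_ge0|exact: ler_pM].
  have -> : c ^+ f * ((A ^+ 4) ^+ f * (16 * (n%:R ^+ 2 + f%:R ^+ 2) * (2 * s) ^+ f)) =
     16 * (n%:R ^+ 2 + f%:R ^+ 2) * (2 * A ^+ 4 * c * s) ^+ f.
    by rewrite !exprMn; ring.
  rewrite -[leRHS]mulrA -exprMn ler_wpM2l ?mulr_ge0 ?addr_ge0 ?exprn_ge0 //.
  apply: lerXn2r; rewrite ?nnegrE ?mulr_ge0 ?exprn_ge0 ?invr_ge0 // ?(ltW A0) ?(ltW c0) ?(ltW q0) //.
  by rewrite ler_pdivlMl //; apply: le_trans qs; lra.
apply: (le_trans H4).
have f2 : f%:R ^+ 2 <= 2 * 2 ^+ f :> R.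
  by rewrite -[2 ^+ f]natrX -natrM -natrX ler_nat sqr_le_exp2.
have n1 : 1 <= n%:R ^+ 2 :> R by rewrite exprn_ege1 // ler1n.
have h4 : (4^-1 : R) ^+ f = 2^-1 ^+ f * 2^-1 ^+ f by rewrite -exprMn; congr (_ ^+ f); field.
have hh : 2^-1 ^+ f * 2 ^+ f = 1 :> R by rewrite -exprMn mulVf ?expr1n // pnatr_eq0.
have h0 : 0 < 2^-1 ^+ f :> R by rewrite exprn_gt0 // invr_gt0.
have h1 : 2^-1 ^+ f <= 1 :> R by rewrite exprn_ile1 // ?invr_ge0 // invf_le1 // ler1n.
rewrite h4; set h := 2^-1 ^+ f in hh h0 h1 *; set t := 2 ^+ f in f2 hh.
have f2h : f%:R ^+ 2 * h <= 2 :> R.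
  by apply: le_trans (_ : 2 * t * h <= _); [rewrite ler_wpM2r // ltW | rewrite -mulrA [t * h]mulrC hh mulr1].
have -> : 16 * (n%:R ^+ 2 + f%:R ^+ 2) * (h * h) = 16 * (n%:R ^+ 2 * h + f%:R ^+ 2 * h) * h by ring.
rewrite ler_wpM2r ?(ltW h0) //.
have : n%:R ^+ 2 * h <= n%:R ^+ 2 by rewrite ler_piMr ?exprn_ge0.
by lra.
Qed.

(** * Complexes of dimension two and their cycles *)

From mathcomp Require Import all_classical all_reals all_analysis.
Import Order.TTheory GRing.Theory Num.Theory.
Local Open Scope ring_scope.

Section Complex.
Variable V : finType.
Implicit Types (s t : {set V}) (Y : {set {set V}}).

Definition complex_faces Y : {set {set V}} := [set s : {set V} | (0 < #|s| <= 2)%N || (s \in Y)]%SET.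

Lemma complex_of_triples Y : (forall s, s \in Y -> #|s| = 3%N) ->
  exists X : simplicial_complex V, faces X = complex_faces Y.
Proof.
move=> Y3.
have H1 s : s \in complex_faces Y -> s != finset.set0.
  by rewrite inE -card_gt0 => /orP[/andP[]//|/Y3->].
have H2 v : [set v]%SET \in complex_faces Y by rewrite inE cards1.
have H3 s t : s \in complex_faces Y -> t != finset.set0 -> t \subset s -> t \in complex_faces Y.
  rewrite !inE -card_gt0 => /orP[/andP[_ s2]|sY] t0 ts; rewrite t0 /=.
    by rewrite (leq_trans (subset_leq_card ts) s2).
  have := subset_leq_card ts; rewrite (Y3 s sY) leq_eqVlt ltnS => /orP[/eqP t3|->//].
  suff -> : t = s by rewrite sY orbT.
  by apply/eqP; rewrite eqEcard ts t3 (Y3 s sY).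
by exists (SimplicialComplex H1 H2 H3).
Qed.

Lemma kfaces_complex Y (X : simplicial_complex V) : (forall s, s \in Y -> #|s| = 3%N) ->
  faces X = complex_faces Y -> kfaces X 2 = Y.
Proof.
move=> Y3 XE; apply/setP => s; rewrite inE XE inE.
apply/andP/idP => [[/orP[/andP[_ s2] /eqP s3|//]]|sY]; first by rewrite s3 in s2.
by rewrite sY orbT (Y3 s sY).
Qed.

Lemma dimension_complex Y (X : simplicial_complex V) : (forall s, s \in Y -> #|s| = 3%N) ->
  Y != finset.set0 -> faces X = complex_faces Y -> dimension X = 2%N.
Proof.
move=> Y3 /set0Pn[s sY] XE; rewrite /dimension XE.
suff -> : \max_(t in complex_faces Y) #|t| = 3%N by [].
apply/eqP; rewrite eqn_leq; apply/andP; split.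
  by apply/bigmax_leqP => t; rewrite inE => /orP[/andP[_ /leqW]|/Y3->].
by rewrite -(Y3 s sY) leq_bigmax_cond // inE sY orbT.
Qed.

Lemma cycle_even_family (X : simplicial_complex V) (z : chain V) :
  is_cycle X 2 z -> even_family (support_chain z).
Proof.
move=> [/fintype.subsetP zX dz].
have z3 s : s \in support_chain z -> #|s| = 3%N.
  by move/zX; rewrite inE => /andP[_ /eqP].
apply/even_familyP; split=> // t t2.
have F2 (a : 'F_2) : a != 0 -> a = 1.
  by case: a => -[|[|//]] // lt _; apply/val_inj.
have := congr1 (fun c : chain V => c t) dz; rewrite !ffunE.
have -> : \sum_(s : {set V}) z s * (\sum_(v in s) (t == s :\ v)%SET%:R) =
    (#|[set s in support_chain z | t \subset s]%SET|)%:R.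
  rewrite -sum1_card natr_sum [RHS]big_mkcond /=; apply: eq_bigr => s _.
  rewrite !inE; have [zs|/F2 zs] := eqVneq (z s) 0; first by rewrite zs mul0r.
  rewrite zs mul1r /=.
  have s3 : #|s| = 3%N by apply: z3; rewrite inE zs.
  case: ifP => ts; last first.
    rewrite big1 // => v vs; case: eqP => // tE.
    by rewrite tE subD1set in ts.
  have /cards1P[v vE] : #|s :\: t| == 1%N.
    by rewrite cardsD (finset.setIidPr ts) s3 t2.
  have : v \in s :\: t by rewrite vE inE.
  rewrite inE => /andP[vt vs]; rewrite (bigD1 v) //= big1 => [|u /andP[us uv]].
    rewrite addr0; suff -> : t == s :\ v by [].
    by rewrite -vE finset.setDDr finset.setDv finset.set0U eq_sym; apply/eqP/finset.setIidPr.
  case: eqP => // tE; have : v \in t by rewrite tE !inE eq_sym uv.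
  by rewrite (negbTE vt).
by move=> /eqP; rewrite -(dvdn_pcharf (pchar_Fp (isT : prime 2))) // dvdn2.
Qed.

(** The support of a nonzero cycle contains a circuit, which is at most as large. *)
Lemma two_girth_ge (R : realType) (X : simplicial_complex V) (x : R) :
  (forall C, circuit C -> #|C|%:R < x -> ~~ (C \subset kfaces X 2)) ->
  (x%:E <= two_girth R X)%E.
Proof.
move=> noC; apply: le_ereal_inf_tmp => _ [z [zc z0 ->]].
rewrite lee_fin leNgt; apply/negP => zx.
have zS0 : support_chain z != finset.set0.
  apply: contra_neq z0 => S0; apply/ffunP => s; rewrite ffunE; apply/eqP.
  by apply: contraFT (finset.in_set0 s) => zs; rewrite -S0 inE.
have [C cC CS] : {C | circuit C & C \subset support_chain z}.
  by apply: minset_exists; rewrite /= (cycle_even_family zc).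
have [zX _] := zc.
have ltC : #|C|%:R < x by apply: le_lt_trans zx; rewrite ler_nat subset_leq_card.
by move/negP: (noC C cC ltC); apply; apply: fintype.subset_trans CS zX.
Qed.

End Complex.

(** * Asymptotics *)

Section Asymptotics.
Variable R : realType.

Lemma powR_eventually_ge (K e : R) : 0 < e ->
  exists N : nat, forall n : nat, (N <= n)%N -> K <= n%:R `^ e.
Proof.
move=> e0; pose M := (`|K| + 1) `^ e^-1.
have K0 : 0 < `|K| + 1 by rewrite ltr_wpDl.
exists (Num.truncn M).+1 => n Mn.
have leM : M <= n%:R.
  by apply: ltW; apply: (lt_le_trans (truncnS_gt M)); rewrite ler_nat.
apply: (@le_trans _ _ (M `^ e)).
  rewrite /M -powRrM mulVf ?gt_eqF // powRr1 ?(ltW K0) //.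
  by rewrite (le_trans (ler_norm K)) // lerDl.
by apply: ge0_ler_powR; rewrite ?nnegrE ?powR_ge0 // ltW.
Qed.

Lemma sum_by_card (I : finType) (Bad : {set {set I}}) M (F : nat -> R) :
  (forall B, B \in Bad -> (0 < #|B| <= M)%N) ->
  \sum_(B in Bad) F #|B| =
  \sum_(1 <= f < M.+1) \sum_(B in Bad | #|B| == f) F f.
Proof.
move=> BM; rewrite (exchange_big_dep (mem Bad)) /=; last by move=> f B _ /andP[].
apply: eq_bigr => B BBad.
have Bin : #|B| \in index_iota 1 M.+1 by rewrite mem_index_iota ltnS BM.
rewrite big_mkcond (bigD1_seq #|B|) ?iota_uniq //= BBad eqxx /=.
rewrite big1 ?addr0 // => f fB.
by rewrite eq_sym (negbTE fB).
Qed.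

(** The expected number of short circuits, summed over their sizes: a geometric series. *)
Lemma short_circuits_weight (n T0 : nat) (x q c s : R) :
  (0 < n)%N -> (0 < T0)%N -> x <= (n ^ 2)%N%:R -> 
  (forall f, n%:R ^+ (3 * (3 * f %/ T0))%N <= c ^+ f) ->
  Num.sqrt n%:R <= s -> Num.sqrt x <= s ->
  0 < c -> 0 < q -> 8 * (3 + 6 * T0%:R) ^+ 4 * c * s <= q ->
  \sum_(C in [set C : {set {set 'I_n}} | circuit C & #|C|%:R < x]%SET) (q ^+ #|C|)^-1
    <= 48 * n%:R ^+ 2.
Proof.
move=> n0 T00 xn cf ns xs c0 q0 qs.
rewrite (@sum_by_card _ _ (n ^ 2) (fun f => (q ^+ f)^-1)); last first.
  move=> C; rewrite inE => /andP[cC Cx]; rewrite (ltnW (circuit_card_gt1 cC)) /=.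
  by rewrite -(ler_nat R) (le_trans (ltW Cx)).
apply: (@le_trans _ _ (\sum_(1 <= f < (n ^ 2).+1) 48 * n%:R ^+ 2 * 2^-1 ^+ f)); last first.
  rewrite -mulr_sumr ler_piMr ?mulr_ge0 ?exprn_ge0 //; exact: sum_half_le.
rewrite big_nat [leRHS]big_nat; apply: ler_sum => f /andP[f0 _].
have rhs0 : 0 <= 48 * n%:R ^+ 2 * 2^-1 ^+ f :> R.
  by rewrite !mulr_ge0 ?exprn_ge0 // invr_ge0.
have [fx|xf] := ltP f%:R x; last first.
  rewrite big1 // => C; rewrite inE => /andP[/andP[_ Cx] /eqP Cf].
  by move: Cx; rewrite Cf ltNge xf.
have fn : (f < n ^ 2)%N by rewrite -(ltr_nat R) (lt_le_trans fx).
have fs : Num.sqrt f%:R <= s by apply: le_trans xs; rewrite ler_wsqrtr // ltW.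
apply: le_trans (count_term_le n0 f0 fn T00 (cf f) ns fs c0 q0 qs).
rewrite sumr_const -[leLHS]mulr_natl ler_wpM2r ?invr_ge0 ?exprn_ge0 // ?(ltW q0) //.
have := @count_circuits 'I_n R f T0 f0 T00; rewrite card_ord; apply: le_trans.
rewrite ler_nat subset_leq_card //; apply/fintype.subsetP => C.
by rewrite unfold_in => /andP[]; rewrite !inE => /andP[-> _] ->.
Qed.

Lemma bin3_ge n : (6 <= n)%N -> n%:R ^+ 3 / 12 <= 'C(n, 3)%:R :> R.
Proof.
move=> n6; have : (6 * 'C(n, 3) = n * (n - 1) * (n - 2))%N.
  by rewrite mulnC (bin_ffact n 3) !ffactnS ffactn0; lia.
move=> E; rewrite ler_pdivrMr // -natrX -natrM ler_nat.
have -> : ('C(n, 3) * 12 = 2 * (6 * 'C(n, 3)))%N by lia.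
by rewrite E; move: n6; rewrite !expnS expn0; clear; nia.
Qed.

End Asymptotics.

Theorem theorem4p1 (R : realType) (alpha eps : R)
    (alpha_gt0 : 0 < alpha) (alpha_lt : alpha < 1 / 2) (eps_gt0 : 0 < eps) :
  exists N : nat, forall n : nat, (N <= n)%N ->
    exists X : simplicial_complex 'I_n,
      [/\ dimension X = 2%N,
          n%:R `^ (2 + alpha) <= #|kfaces X 2|%:R :> R &
          ((n%:R `^ (2 - 2 * alpha - eps))%:E <= two_girth R X)%E].
Proof.
(* [eta] is the room in the exponents: [1/2 - alpha] for circuits with at most [n] triangles and
   [eps / 2] for larger ones. Half of it is spent on the profile, the other half on constants. *)
pose eta := Num.min (1 / 2 - alpha) (eps / 2).
have eta0 : 0 < eta by rewrite lt_min; apply/andP; split; lra.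
have eta1 : eta <= 1 / 2 - alpha by rewrite ge_min lexx.
have eta2 : eta <= eps / 2 by rewrite ge_min lexx orbT.
pose T0 := (Num.truncn (18 / eta)).+1.
have T0eta : 9 / T0%:R <= eta / 2.
  have := truncnS_gt (18 / eta); rewrite -/T0 ltr_pdivrMr // => H.
  by rewrite ler_pdivrMr ?ltr0n //; lra.
pose K : R := 256 * (3 + 6 * T0%:R) ^+ 4.
have e2 : 0 < eta / 2 by lra.
have a1 : 0 < 1 - alpha by lra.
have [N1 HN1] := powR_eventually_ge K e2.
have [N2 HN2] := powR_eventually_ge 16 a1.
have [N3 HN3] := powR_eventually_ge 144 alpha_gt0.
exists (maxn 6 (maxn N1 (maxn N2 N3))) => n; rewrite !geq_max => /and4P[n6 nN1 nN2 nN3].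
have n0 : (0 < n)%N by apply: leq_trans n6.
have nR0 : 0 < n%:R :> R by rewrite ltr0n.
have nR1 : 1 <= n%:R :> R by rewrite ler1n.
have powD a b : n%:R `^ (a + b) = n%:R `^ a * n%:R `^ b :> R.
  by apply: powRD; rewrite (gt_eqF nR0) implybT.
have pow_gt0 a : 0 < n%:R `^ a :> R by rewrite powR_gt0.
have pow_le a b : a <= b -> n%:R `^ a <= n%:R `^ b :> R by move=> ab; rewrite ler_powR.
(* The number of colours before rounding. There are at least [n^3 / 12] triangles, so a colour class has
   at least [4/3 n^(2 + alpha)] of them on average, which leaves room for the deletions. *)
pose y : R := n%:R `^ (1 - alpha) / 16.
have y1 : 1 <= y by rewrite /y ler_pdivlMr // mul1r HN2.
pose q := Num.truncn y.
have q0 : (0 < q)%N by rewrite truncn_gt0.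
have qy : q%:R <= y by rewrite truncn_le; lra.
have yq : y <= 2 * q%:R.
  have := truncnS_gt y; rewrite -/q -natr1; have : 1 <= q%:R :> R by rewrite ler1n.
  by lra.
pose x : R := n%:R `^ (2 - 2 * alpha - eps).
pose c : R := n%:R `^ (9 / T0%:R).
(* By the choice of [eta], this bounds both [n^(1/2)] and the square root of [x]. *)
pose s : R := n%:R `^ (1 - alpha - eta).
pose U : {set {set 'I_n}} := [set F : {set 'I_n} | #|F| == 3%N]%SET.
pose Bad : {set {set {set 'I_n}}} := [set C | circuit C & #|C|%:R < x]%SET.
have Bad0 : finset.set0 \notin Bad.
  by apply/negP; rewrite inE => /andP[/circuit_card_gt1]; rewrite cards0.
have [Y [YU YB Ysize]] := @deletion_method R _ U Bad q q0 Bad0.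
have weight : \sum_(C in Bad) (q%:R ^+ #|C|)^-1 <= 48 * n%:R ^+ 2 :> R.
  apply: (@short_circuits_weight R n T0 x q%:R c s) => //.
  - rewrite natrX -powR_mulrn //; apply: pow_le; lra.
  - move=> f.
    have -> : c ^+ f = n%:R `^ (9 / T0%:R * f%:R) by rewrite -powR_mulrn ?powR_ge0 // -powRrM.
    have -> m : n%:R ^+ m = n%:R `^ m%:R :> R by rewrite powR_mulrn.
    apply: pow_le; rewrite mulrAC ler_pdivlMr ?ltr0n // -!natrM ler_nat.
    by rewrite -mulnA (leq_trans (leq_mul (leqnn 3) (leq_divM _ _))) // mulnA.
  - by rewrite -powR12_sqrt //; apply: pow_le; lra.
  - rewrite -powR12_sqrt ?powR_ge0 // -powRrM; apply: pow_le; lra.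
  - exact: pow_gt0.
  - by rewrite ltr0n.
  - have HK := HN1 n nN1; rewrite -/K in HK.
    have cs : c * s <= n%:R `^ (1 - alpha - eta / 2).
      by rewrite -powD; apply: pow_le; lra.
    have E : n%:R `^ (1 - alpha) = n%:R `^ (1 - alpha - eta / 2) * n%:R `^ (eta / 2) :> R.
      by rewrite -powD; congr (_ `^ _); lra.
    suff : K * (c * s) <= n%:R `^ (1 - alpha).
      rewrite /K; rewrite /y in yq; lra.
    rewrite E mulrC; apply: ler_pM cs HK; first by apply: mulr_ge0; apply/ltW/pow_gt0.
    by apply: mulr_ge0; [|apply: exprn_ge0; apply: addr_ge0; [|apply: mulr_ge0]].
have Y3 F : F \in Y -> #|F| = 3%N.
  by move/(fintype.subsetP YU); rewrite inE => /eqP.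
have cU : #|U| = 'C(n, 3) by rewrite /U card_draws card_ord.
have sizeY : n%:R `^ (2 + alpha) <= #|Y|%:R :> R.
  apply: le_trans Ysize; rewrite lerBrDr (le_trans (lerD (lexx _) weight)) // cU.
  have q0' : 0 < q%:R :> R by rewrite ltr0n.
  rewrite ler_pdivlMr //; apply: le_trans (bin3_ge R n6).
  have E3 : n%:R ^+ 3 = n%:R `^ (2 + alpha) * n%:R `^ (1 - alpha) :> R.
    by rewrite -powD -powR_mulrn //; congr (_ `^ _); lra.
  have E2 : n%:R `^ (2 + alpha) = n%:R ^+ 2 * n%:R `^ alpha :> R.
    by rewrite powD powR_mulrn.
  have n2 : 144 * n%:R ^+ 2 <= n%:R `^ (2 + alpha) :> R.
    by rewrite E2 mulrC ler_wpM2l ?exprn_ge0 // HN3.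
  apply: (@le_trans _ _ (4 / 3 * n%:R `^ (2 + alpha) * y)).
    apply: ler_pM qy; [|exact: ltW|by lra].
    by apply: addr_ge0; [exact: ltW (pow_gt0 _) | apply: mulr_ge0; [|exact: exprn_ge0]].
  by rewrite E3 /y; lra.
have [X XE] := complex_of_triples Y3.
have kX := kfaces_complex Y3 XE.
exists X; split; last 2 first.
- by rewrite kX.
- apply: two_girth_ge => C cC Cx; rewrite kX; apply: YB.
  by rewrite inE cC.
apply: dimension_complex XE => //; rewrite -card_gt0 -(ltr_nat R).
exact: lt_le_trans sizeY.
Qed.
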